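(* For every oriented cycle $C \ne C_3$ and every $\varepsilon > 0$ there exists $n_0 = n_0(C,\varepsilon)$ such that the following holds for every oriented graph $G$ on $n \ge n_0$ vertices: (1) if $t(C) \ge 1$ and $\delta^\pm(G) \ge \frac{n}{k(C)} + \varepsilon n$, then $G$ contains $C$; (2) if $t(C) = 0$ and $\delta^\pm(G) \ge \varepsilon n$, then $G$ contains $C$. Moreover, the bounds on the semidegree are asymptotically best possible; that is, if $t(C) \ge 1$, then for every real $c < \frac{1}{k(C)}$ there are infinitely many $n$ for which there is an oriented graph $G$ on $n$ vertices with $\delta^\pm(G) \ge cn$ that does not contain $C$ (and for $t(C)=0$ the leading coefficient $0$ trivially cannot be lowered).
   Context: An oriented graph is a finite directed graph without loops and without multiple edges regardless of direction (at most one of $uw$, $wu$ is an edge). $\delta^\pm(G)$, the minimum semidegree, is the minimum of the minimum outdegree and the minimum indegree of $G$. ''Contains'' means as a (not necessarily induced) subgraph. An oriented cycle is an undirected cycle (of length at least $3$) whose edges are each given an arbitrary direction, not necessarily the cyclic one; $C_3$ denotes the directed triangle (cyclic orientation). For an oriented cycle $C$, the cycle-type $t(C)$ is the absolute value of the difference between the number of edges of $C$ oriented forwards and the number of edges oriented backwards, with respect to a fixed cyclic traversal of $C$. If $t(C) \ge 1$, then $k(C)$ is the smallest integer greater than $2$ that does not divide $t(C)$. *)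

(* Defs.v *)
From mathcomp Require Import all_boot all_order all_algebra.
From mathcomp Require Import zify reals.

Set Implicit Arguments.
Unset Strict Implicit.
Unset Printing Implicit Defensive.

Import IntDist.

Record oriented_graph := OrientedGraph {
  vertex :> finType;
  arc : rel vertex;
  arc_irrefl : forall x, ~~ arc x x;
  arc_asym : forall x y, arc x y -> ~~ arc y x
}.

Section OrientedGraphs.
Variable G : oriented_graph.

Definition outdeg (x : G) : nat := #|[set y | arc x y]|.
Definition indeg (x : G) : nat := #|[set y | arc y x]|.

(* The default #|G| exceeds every degree, so it only matters (and gives 0)
   for the graph with no vertices. *)
Definition min_outdeg : nat := \big[minn/#|G|]_(x : G) outdeg x.
Definition min_indeg : nat := \big[minn/#|G|]_(x : G) indeg x.
Definition min_semideg : nat := minn min_outdeg min_indeg.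

End OrientedGraphs.

Definition contains (G H : oriented_graph) : Prop :=
  exists f : H -> G, injective f /\ (forall x y, arc x y -> arc (f x) (f y)).

(* The vertices are 'I_len, traversed in the cyclic order i, ordS i, ...;
   edge number i joins i and ordS i, and is directed from i to ordS i
   if [fwd i] and from ordS i to i otherwise. *)
Record oriented_cycle := OrientedCycle {
  len : nat;
  len_ge3 : 2 < len;
  fwd : pred 'I_len
}.

Section OrientedCycles.
Variable C : oriented_cycle.

Definition cycle_arc : rel 'I_(len C) := fun x y =>
  (y == ordS x) && fwd x || (x == ordS y) && ~~ fwd y.

Lemma ordS_neq (x : 'I_(len C)) : x != ordS x.
Proof.
have l3 := len_ge3 C; apply/eqP => /(congr1 val) /=.
case: (ltnP x.+1 (len C)) => [lt|ge]; first by rewrite modn_small //; lia.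
have -> : x.+1 = len C by have := ltn_ord x; lia.
by rewrite modnn => x0; have := ltn_ord x; lia.
Qed.

Lemma ordSS_neq (x : 'I_(len C)) : x != ordS (ordS x).
Proof.
have l3 := len_ge3 C; apply/eqP => /(congr1 val) /=.
rewrite -addn1 modnDml addn1; case: (ltnP x.+2 (len C)) => [lt|ge].
  by rewrite modn_small //; lia.
have lx := ltn_ord x.
have -> : x.+2 = (x.+2 - len C) + len C by lia.
by rewrite modnDr modn_small; lia.
Qed.

Lemma cycle_arc_irrefl x : ~~ cycle_arc x x.
Proof. by rewrite /cycle_arc (negbTE (ordS_neq x)). Qed.

Lemma cycle_arc_asym x y : cycle_arc x y -> ~~ cycle_arc y x.
Proof.
rewrite /cycle_arc => /orP[] /andP[/eqP-> fx]; rewrite negb_or !negb_and.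
  by rewrite (negbTE (ordSS_neq x)) fx orbT.
by rewrite (negbTE (ordSS_neq y)) (negbTE fx) orbT.
Qed.

Definition cycle_graph : oriented_graph :=
  OrientedGraph cycle_arc_irrefl cycle_arc_asym.

Definition is_directed_triangle : Prop :=
  len C = 3 /\ (forall i j : 'I_(len C), fwd i = fwd j).

(* The subtraction is the one on int, not the truncated one on nat. *)
Definition cycle_type : nat :=
  `| #|[set i | @fwd C i]| - #|[set i | ~~ @fwd C i]| |%N.

Lemma cycle_k_exists :
  0 < cycle_type -> exists m, (2 < m) && ~~ (m %| cycle_type).
Proof.
move=> t0; exists (cycle_type + 3).
rewrite addn3 /=; apply/negP => /(dvdn_leq t0); lia.
Qed.

Definition cycle_k (t_gt0 : 0 < cycle_type) : nat :=
  ex_minn (cycle_k_exists t_gt0).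

End OrientedCycles.

(* Main.v *)
Require Import Defs.
From mathcomp Require Import all_boot all_order all_algebra.
From mathcomp Require Import reals.
From mathcomp Require Import zify ring lra.
Set Implicit Arguments.
Unset Strict Implicit.
Unset Printing Implicit Defensive.
Import Order.TTheory GRing.Theory Num.Theory.

(** Let t be the cycle-type of C and k the smallest integer above 2 that does
    not divide t.

    Upper bound.  An oriented graph G with semidegree at least (1/k + eps)n is
    sampled: for a fixed m, most maps from m indices to the vertices of G
    induce, after deletion of a few indices of untypical degree, an oriented
    graph H of semidegree more than |H|/k ([many_good], by second moments).  If
    every such H receives a homomorphism from C, then a positive proportion of
    the m-tuples of G carry one and the same homomorphic pattern; a dense set
    of m-tuples contains a box with large sides ([box]), so each vertex of the
    pattern can be replaced by as many distinct vertices as C needs, which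
    gives an injective copy ([sampling]).

    So it remains to map C into every oriented graph H with semidegree d and
    k d > |H|.  Heights along C take values in the integers and increase by t or
    -t around C.  If t = 0, C maps to a long directed walk.  If H has a closed
    directed walk of length t, C wraps around it ([hom_closed_walk]).  For t at
    most 3 this may fail, but then C has edges in both directions, and an arc
    from x to y together with a walk of length t + 1 from x to y suffices
    ([hom_shortcut]); such a shortcut is found by packing k pairwise disjoint
    neighbourhoods of size d ([shortcut2], [shortcut3], [shortcut4]).

    The core is therefore [closed_walk]: if t >= 4 there is a closed walk of
    length t.  Assume not.  Then closed walks of length dividing t are excluded
    as well, in particular all those shorter than k.  Starting at x, take
    S = N+(x) and repeatedly add to S the out-neighbourhood of a vertex of S
    without out-neighbours in S: each step adds d new vertices.  As k d > |H|,
    this gets stuck after fewer than k steps at a set S of vertices at distance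
    at most g < k from x in which every vertex has an out-neighbour.  Such an S
    contains a set in which one can walk backwards for ever, so some w in S is
    reached from x by walks with a length in every window of g consecutive
    integers: the pair (x, w) is g-flexible ([sink_or_flexible]).  If w can return
    to x within r steps, x lies on closed walks of two lengths differing by some
    d' <= g; if d' divides t, which always holds for k >= 5, combining the two
    gives length t as soon as t >= (r + g)(r + 2g) ([two_lengths], [closableP]).

    To bound r, one shows that every vertex set A has a vertex whose
    out-neighbours inside A number less than |A|/m ([sparse_of]): in a smallest
    counterexample, a vertex v of large in-degree either has m - 1 disjoint
    out-neighbourhoods in its ball, disjoint from its in-neighbourhood, or is
    the start of a flexible pair (v, w) without a quick return, so that the
    large ball of w misses the in-neighbourhood of v.  Sparseness makes balls
    grow like m d (1 - (1 - 1/m)^n), and as soon as two balls together exceed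
    |H|, all pairs of vertices are linked by short walks ([linked_num]).

    All integers from 3 to k - 1 divide t, so that t is at least of the order
    of k^5 ([common_multiple_large]), whereas the lengths needed are of the
    order of k^2 (log k)^2; this settles k >= 13.  The prime powers 7, 8, 9, 11
    need explicit parameters, and 3, 4, 5 need finer arguments.

    Lower bound.  The blow-up of the directed k-cycle with equal classes has
    semidegree n/k, and it contains C only if C winds around the k-cycle, hence
    only if k divides t ([blowup_free]). *)

(** * Walks, flexible pairs and growing balls *)

Section Walks.
Variable V : finType.
Implicit Types (e : rel V) (x y z : V) (A S : {set V}) (l m n d g : nat).

Definition converse e : rel V := fun x y => e y x.

Fixpoint walk e n x y : bool :=
  if n is n'.+1 then [exists z, e x z && walk e n' z y] else x == y.

Lemma walk0 e x : walk e 0 x x. Proof. by rewrite /=. Qed.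

Lemma walk1 e x y : walk e 1 x y = e x y.
Proof.
apply/existsP/idP => [[z /andP[exz /eqP <-]] //|exy].
by exists y; rewrite exy /=.
Qed.

Lemma walkS e n x z y : e x z -> walk e n z y -> walk e n.+1 x y.
Proof. by move=> exz w; apply/existsP; exists z; rewrite exz. Qed.

Lemma walk_cat e m n x y z :
  walk e m x y -> walk e n y z -> walk e (m + n) x z.
Proof.
elim: m x => [|m IH] x /=; first by move/eqP->.
by case/existsP => u /andP[exu wu] wy; apply: (walkS exu); apply: IH wy.
Qed.

Lemma walk_split e m n x z :
  walk e (m + n) x z -> exists2 y, walk e m x y & walk e n y z.
Proof.
elim: m x => [|m IH] x /= w; first by exists x.
have /existsP[u /andP[exu wu]] := w.
by have [y wy wyz] := IH _ wu; exists y => //; apply/existsP; exists u; rewrite exu.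
Qed.

Lemma walk_rcons e n x y z : walk e n x y -> e y z -> walk e n.+1 x z.
Proof. by move=> w; rewrite -walk1 => w1; rewrite -addn1; apply: walk_cat w1. Qed.

Lemma walk_lastP e n x z :
  walk e n.+1 x z -> exists2 y, walk e n x y & e y z.
Proof. by rewrite -addn1 => /walk_split[y wy]; rewrite walk1; exists y. Qed.

Lemma walk_converse e n x y : walk (converse e) n x y = walk e n y x.
Proof.
elim: n x y => [|n IH] x y; first by rewrite /= eq_sym.
apply/existsP/idP => [[z /andP[ezx]]|/walk_lastP[z wz ezx]].
  by rewrite -/(walk (converse e) n z y) IH => w; apply: walk_rcons w ezx.
by exists z; rewrite -/(walk (converse e) n z y) IH wz /converse ezx.
Qed.

Lemma walk_mul e n c x : walk e n x x -> walk e (c * n) x x.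
Proof.
move=> w; elim: c => [|c IH]; first by rewrite mul0n walk0.
by rewrite mulSn; apply: walk_cat IH.
Qed.

Lemma walk_dvd e n t x : n %| t -> walk e n x x -> walk e t x x.
Proof. by case/dvdnP => c ->; exact: walk_mul. Qed.

(** The length of the walk is not prescribed, only bounded by n: balls are
    easier to enlarge than the sets of vertices reached in exactly n steps. *)
Definition within e n S x :=
  forall y, y \in S -> exists l, [/\ 0 < l, l <= n & walk e l x y].

(** Knowing a walk length in every window of g consecutive integers replaces
    the exact set of lengths; for g = 1 all positive lengths occur. *)
Definition flexible e g x y :=
  forall N, exists l, [/\ N < l, l <= N + g & walk e l x y].

(** Out-neighbours inside A, so that degrees of induced subgraphs need no
    subtypes. *)
Definition nbr e A x := [set y in A | e x y].

Lemma in_nbr e A x y : (y \in nbr e A x) = (y \in A) && e x y.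
Proof. by rewrite inE. Qed.

Lemma nbr_sub e A x : nbr e A x \subset A.
Proof. by apply/subsetP => y; rewrite in_nbr => /andP[]. Qed.

Lemma sum_card_nbr e A B :
  \sum_(x in A) #|nbr e B x| = \sum_(x in A) \sum_(y in B) nat_of_bool (e x y).
Proof.
apply: eq_bigr => x _; rewrite -sum1_card big_mkcond [RHS]big_mkcond /=.
by apply: eq_bigr => y _; rewrite in_nbr; case: (y \in B); case: (e x y).
Qed.

Lemma sum_card_nbr_converse e A :
  \sum_(x in A) #|nbr e A x| = \sum_(x in A) #|nbr (converse e) A x|.
Proof. by rewrite !sum_card_nbr exchange_big. Qed.

(** In an inclusion-minimal set whose vertices all have an out-neighbour in
    the set, the out-neighbours again form such a set, hence are everything.
    *)
Lemma recurrent_core e S : S != set0 ->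
  (forall y, y \in S -> exists2 z, z \in S & e y z) ->
  exists O : {set V}, [/\ O != set0, O \subset S &
    forall z, z \in O -> exists2 y, y \in O & e y z].
Proof.
move=> S0 out.
pose P (O : {set V}) := [&& O != set0, O \subset S &
   [forall y in O, [exists z in O, e y z]]].
have PS : P S.
  rewrite /P S0 subxx /=; apply/forall_inP => y /out[z zS eyz].
  by apply/exists_inP; exists z.
case: (arg_minnP (fun O : {set V} => #|O|) PS) => O /and3P[O0 OS /forall_inP outO] minO.
exists O; split=> // z zO.
pose O' := [set u in O | [exists y in O, e y u]].
have O'O : O' \subset O by apply/subsetP => u; rewrite inE => /andP[].
have PO' : P O'.
  have mem u v : u \in O -> v \in O -> e u v -> v \in O'.
    by move=> uO vO euv; rewrite inE vO /=; apply/exists_inP; exists u.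
  apply/and3P; split.
  - have [u uO] := set0Pn _ O0; have /exists_inP[v vO euv] := outO u uO.
    by apply/set0Pn; exists v; apply: mem euv.
  - exact: subset_trans OS.
  apply/forall_inP => u uO'; have uO := subsetP O'O _ uO'.
  have /exists_inP[v vO euv] := outO u uO.
  by apply/exists_inP; exists v => //; apply: mem euv.
have O'E : O' = O.
  by apply/eqP; rewrite eqEcard O'O; exact: minO.
by move: zO; rewrite -{1}O'E inE => /andP[_ /exists_inP[y yO eyz]]; exists y.
Qed.

Lemma recurrent_core_back e (O : {set V}) w N :
  (forall z, z \in O -> exists2 y, y \in O & e y z) -> w \in O ->
  exists2 u, u \in O & walk e N u w.
Proof.
move=> inO wO; elim: N => [|N [u uO wu]]; first by exists w; rewrite ?walk0.
by have [y yO eyu] := inO u uO; exists y => //; exact: (walkS eyu wu).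
Qed.

Lemma recurrent_core_flexible e (O : {set V}) g x w :
  (forall z, z \in O -> exists2 y, y \in O & e y z) -> within e g O x ->
  w \in O -> flexible e g x w.
Proof.
move=> inO wi wO N; have [u uO wu] := recurrent_core_back N inO wO.
have [l [l0 lg wl]] := wi u uO.
exists (l + N); split; [lia|lia|exact: walk_cat wl wu].
Qed.

Lemma within_sub e n S S' x : S' \subset S -> within e n S x -> within e n S' x.
Proof. by move=> /subsetP s wi y /s /wi. Qed.

(** Without a sink, S contains a recurrent core. Walking N steps backwards in
    it from w ends at a vertex that x reaches with some length in [1, g],
    whence a walk from x to w with length in [N + 1, N + g]. *)
Lemma sink_or_flexible e S g x : S != set0 -> within e g S x ->
  (exists2 y, y \in S & forall z, z \in S -> ~~ e y z) \/
  (exists2 w, w \in S & flexible e g x w).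
Proof.
move=> S0 wi.
case: (boolP [exists y in S, [forall z in S, ~~ e y z]]).
  by case/exists_inP => y yS /forall_inP sink; left; exists y.
rewrite negb_exists_in => /forall_inP nosink; right.
have [|O [O0 OS inO]] := @recurrent_core e S S0.
  move=> y /nosink; rewrite negb_forall_in => /exists_inP[z zS].
  by rewrite negbK; exists z.
have [w wO] := set0Pn _ O0; exists w; first exact: (subsetP OS).
exact: recurrent_core_flexible inO (within_sub OS wi) wO.
Qed.

Lemma within_nbr e A x : within e 1 (nbr e A x) x.
Proof. by move=> y; rewrite in_nbr -(walk1 e) => /andP[_ w]; exists 1. Qed.

Lemma within_grow e A n S x w : w \in S -> within e n S x ->
  within e n.+1 (S :|: nbr e A w) x.
Proof.
move=> wS wi y; rewrite in_setU in_nbr => /orP[/wi[l [l0 lm wl]]|/andP[_ ewy]].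
  by exists l; split=> //; lia.
have [l [l0 lm wl]] := wi w wS.
by exists l.+1; split=> //; apply: walk_rcons wl ewy.
Qed.

(** The out-neighbourhood of a sink of S is disjoint from S, so adding it
    enlarges the ball by d vertices for one more step. *)
Lemma flexible_or_ball e A d x n : 0 < d -> x \in A ->
  (forall y, y \in A -> d <= #|nbr e A y|) ->
  (exists2 w, w \in A & flexible e n x w) \/
  (exists S, [/\ S \subset A, within e n.+1 S x & n.+1 * d <= #|S|]).
Proof.
move=> d0 xA deg; elim: n => [|n IH].
  right; exists (nbr e A x); split; first exact: nbr_sub.
    exact: within_nbr.
  by rewrite mul1n deg.
case: IH => [[w wA fl]|[S [SA wi cS]]].
  left; exists w => // N; have [l [? ? ?]] := fl N; exists l; split=> //; lia.
have S0 : S != set0 by rewrite -card_gt0; nia.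
case: (sink_or_flexible S0 wi) => [[y yS sink]|[w wS fl]]; last first.
  by left; exists w => //; apply: (subsetP SA).
right; exists (S :|: nbr e A y); split.
- by rewrite subUset SA nbr_sub.
- exact: within_grow.
rewrite cardsU (_ : S :&: nbr e A y = set0) ?cards0 ?subn0.
  by rewrite mulSn addnC leq_add ?deg // (subsetP SA).
apply/setP => z; rewrite in_setI in_nbr in_set0; apply/negP.
by case/and3P => zS _; apply/negP/sink.
Qed.

(** The restriction to subsets of B lets an induction on |B| use sparseness
    below B. *)
Definition sparse e m (B : {set V}) :=
  forall A, A \subset B -> A != set0 -> exists2 v, v \in A & m * #|nbr e A v| < #|A|.

(** The vertex w wastes less than |S|/m of its out-neighbours inside S. *)
Lemma sparse_grow_card e m A d S w : m * #|nbr e S w| < #|S| -> d <= #|nbr e A w| ->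
  m.-1 * #|S| + m * d <= m * #|S :|: nbr e A w|.
Proof.
move=> lt dw; rewrite cardsU.
have : #|S :&: nbr e A w| <= #|nbr e S w|.
  apply: subset_leq_card; apply/subsetP => z; rewrite in_setI !in_nbr.
  by case/and3P => -> _ ->.
have : #|S :&: nbr e A w| <= #|S| by rewrite subset_leq_card // subsetIl.
move: (#|_ :&: _|) => c cS cn.
case: m lt => [|m] lt /=; first lia.
nia.
Qed.

Lemma sparse_grow e m B A d n S x : sparse e m B ->
  (forall y, y \in A -> d <= #|nbr e A y|) ->
  S \subset A -> S \subset B -> S != set0 -> within e n S x ->
  exists S', [/\ S' \subset A, within e n.+1 S' x, S \subset S' &
     m.-1 * #|S| + m * d <= m * #|S'|].
Proof.
move=> sp deg SA SB S0 wi; have [w wS lt] := sp S SB S0.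
exists (S :|: nbr e A w); split; rewrite ?subsetUl //.
- by rewrite subUset SA nbr_sub.
- exact: within_grow.
exact: sparse_grow_card lt (deg w (subsetP SA _ wS)).
Qed.

Lemma disjoint_by (A B : {set V}) :
  (forall z, z \in A -> z \in B -> False) -> [disjoint A & B].
Proof.
move=> dis; rewrite disjoint_subset; apply/subsetP => z zA.
by apply/negP; apply: dis.
Qed.

Lemma disjoint_card d (s : seq {set V}) : pairwise (fun A B => [disjoint A & B]) s ->
  all (fun A => d <= #|A|) s -> size s * d <= #|V|.
Proof.
move=> dis big; apply: leq_trans (max_card (\bigcup_(A <- s) A)).
elim: s dis big => [|A s IH] /=; first by rewrite mul0n.
case/andP => /allP dA ds /andP[bA bs].
rewrite big_cons cardsU (_ : A :&: _ = set0) ?cards0 ?subn0 ?mulSn ?leq_add ?IH //.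
apply/eqP; rewrite setI_eq0 bigcup_seq; apply: disjoint_by => z zA /bigcupP[B Bs zB].
by have := dA B Bs; move/disjointFr => /(_ _ zA); rewrite zB.
Qed.

End Walks.

(** * Sums of closed walk lengths, and sparse vertex sets *)

Definition sum_closed (L : nat -> Prop) := forall a b, L a -> L b -> L (a + b).

(** L stands for the lengths of the closed walks at a vertex x that starts a
    g-flexible pair (x, w) such that w returns to x within r steps. *)
Definition closable t g r := forall L : nat -> Prop, sum_closed L ->
  (forall N, r <= N -> exists l, [/\ N < l, l <= N + g & L l]) -> L t.

Lemma sum_closed_mul L a x : sum_closed L -> L x -> 0 < a -> L (a * x).
Proof.
move=> add Lx; elim: a => [|[|a] IH] // _; first by rewrite mul1n.
by rewrite mulSn; apply: add => //; apply: IH.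
Qed.

Lemma sum_closed_comb L a b x y : sum_closed L -> L x -> L y ->
  0 < a * x + b * y -> L (a * x + b * y).
Proof.
move=> add Lx Ly; case: (posnP a) => [->|a0]; case: (posnP b) => [->|b0] pos.
- by move: pos; rewrite !mul0n.
- by rewrite mul0n add0n; apply: sum_closed_mul.
- by rewrite mul0n addn0; apply: sum_closed_mul.
by apply: (add _ _); apply: sum_closed_mul.
Qed.

(** Write t = d (m x + j) with j < x. Then d m loops, of which j have length x
    + d and the others length x, have total length t; the bound on t ensures j
    <= d m. *)
Lemma two_lengths x d t : 0 < x -> 0 < d -> d %| t -> x * (x + d - 2) <= t ->
  exists a b, t = a * x + b * (x + d).
Proof.
move=> x0 d0 /dvdnP[q ->] le.
have E := divn_eq q x; set m := q %/ x in E; set j := q %% x in E.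
have jx : j < x by rewrite ltn_mod.
have le_j : j <= d * m by rewrite leqNgt; apply/negP => lt; nia.
exists (d * m - j), j; nia.
Qed.

(** Two successive members of L beyond r differ by a number at most g, which
    divides t. *)
Lemma closableP t g r : 0 < t -> (forall d, 0 < d -> d <= g -> d %| t) ->
  (r + g) * (r + g + g - 2) <= t -> closable t g r.
Proof.
move=> t0 dv le L add win.
have [x [rx xg Lx]] := win r (leqnn r).
have [y [xy yg Ly]] := win x (ltnW rx).
have [|||| a [b E]] := @two_lengths x (y - x) t; [lia|lia| | |].
- apply: dv; lia.
- have : x * (x + (y - x) - 2) <= (r + g) * (r + g + g - 2); [apply: leq_mul; lia|lia].
by rewrite E subnKC ?(ltnW xy) // in t0 *; apply: sum_closed_comb.
Qed.

Lemma closable_mono t g g' r r' : g' <= g -> r' <= r -> closable t g r -> closable t g' r'.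
Proof.
move=> gg rr cl L add win; apply: cl => // N rN.
by have [|l [? ? ?]] := win N; [lia|exists l; split=> //; lia].
Qed.

Lemma closable1 t r : r < t -> closable t 1 r.
Proof.
case: t => // t rt L _ win; have [//|l [tl lt Ll]] := win t.
by have -> : t.+1 = l by lia.
Qed.

Section Sparse.
Variable V : finType.
Implicit Types (e : rel V) (x y z v w : V) (A B S : {set V}).

Lemma closable_flexible e t g r v w p : closable t g r -> flexible e g v w ->
  walk e p w v -> p <= r -> walk e t v v.
Proof.
move=> cl fl wp pr; apply: (cl (fun l => walk e l v v)).
  by move=> a b wa; apply: walk_cat.
move=> N rN; have [l [l1 l2 wl]] := fl (N - p).
exists (l + p); split; [lia|lia|exact: walk_cat wl wp].
Qed.

(** Iterating |S'| >= (1 - 1/m)|S| + d from a single neighbourhood gives |S|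
    >= m d (1 - (1 - 1/m)^n). *)
Lemma sparse_grow_iter e m A d n x N : 0 < m -> 0 < d ->
  (forall y, y \in A -> d <= #|nbr e A y|) -> x \in A ->
  (forall S i, S \subset A -> 0 < i <= N -> within e i S x -> sparse e m S) ->
  0 < n -> n <= N.+1 ->
  exists S, [/\ S \subset A, within e n S x &
     m ^ n * (m * d) <= m ^ n * #|S| + m.-1 ^ n * (m * d)].
Proof.
move=> m0 d0 deg xA sp; elim: n => [//|[_ _ _|n IH _ nN]].
  exists (nbr e A x); split; [exact: nbr_sub|exact: within_nbr|].
  have := deg x xA; rewrite !expn1; move: #|_| => c; case: (m) m0 => // m' _ /=; nia.
have [|S [SA wi le]] := IH isT; first lia.
have [S0|S0] := eqVneq S set0.
  move: le; rewrite S0 cards0 muln0 add0n leq_pmul2r; last lia.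
  rewrite leqNgt ltn_exp2r //; case: (m) m0 => // m' _ /=; lia.
have [|S' [S'A wi' SS' le']] := sparse_grow (sp _ _ SA _ wi) deg SA (subxx _) S0 wi; first lia.
exists S'; split=> //.
move: le le'; rewrite !(expnSr _ n.+1); set a := m ^ _; set b := _ ^ n.+1.
case: (m) m0 => // m' _ /= le le'.
have : a * (m' * #|S| + m'.+1 * d) <= a * (m'.+1 * #|S'|) by rewrite leq_mul2l le' orbT.
have : m' * (a * (m'.+1 * d)) <= m' * (a * #|S| + b * (m'.+1 * d)) by rewrite leq_mul2l le orbT.
nia.
Qed.

(** An inductive argument in the style of Caccetta and Haggkvist. In a
    smallest counterexample A, of minimum out-degree d >= |A|/m, choose v with
    in-degree at least d. If v is not the start of an (m - 2)-flexible pair,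
    its ball of radius m - 1 has (m - 1)d vertices, and it avoids the in-
    neighbours of v because short closed walks are excluded. Otherwise let (v,
    w) be that pair: as w does not return quickly, its balls up to radius T
    avoid the in-neighbours of v, so they are proper subsets of A and keep
    growing by induction, up to (m - 1)d vertices. Both cases yield |A| > m d.
    *)
Lemma sparse_of e m T : 1 < m ->
  (forall v l, 0 < l <= m -> ~~ walk e l v v) ->
  (forall v w p, flexible e (m - 2) v w -> 0 < p <= T.+1 -> ~~ walk e p w v) ->
  m * m.-1 ^ T <= m ^ T -> sparse e m setT.
Proof.
move=> m1 girth ret num A _.
have [n] := ubnP #|A|; elim: n A => // n IH A ltn A0.
case: (boolP [exists v in A, m * #|nbr e A v| < #|A|]).
  by case/exists_inP => v vA lt; exists v.
rewrite negb_exists_in => /forall_inP dense_oriented; exfalso.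
have cA : 0 < #|A| by rewrite card_gt0.
pose d := (#|A| + m.-1) %/ m.
(* d is |A|/m rounded up *)
have dP : #|A| <= m * d.
  rewrite /d; have := divn_eq (#|A| + m.-1) m.
  have : (#|A| + m.-1) %% m < m by rewrite ltn_mod; lia.
  lia.
have d0 : 0 < d by case: (d) dP => //; rewrite muln0; lia.
have dlt : m * d < #|A| + m by rewrite /d; have := leq_trunc_div (#|A| + m.-1) m; nia.
have deg y : y \in A -> d <= #|nbr e A y|.
  by move/dense_oriented; rewrite -leqNgt => le; rewrite leqNgt; apply/negP => lt; nia.
have [v vA dv] : exists2 v, v \in A & d <= #|nbr (converse e) A v|.
  case: (boolP [exists v in A, d <= #|nbr (converse e) A v|]).
    by case/exists_inP => v vA lt; exists v.
  rewrite negb_exists_in => /forall_inP sm; exfalso.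
  have: \sum_(x in A) d <= \sum_(x in A) #|nbr e A x| by apply: leq_sum.
  rewrite sum_card_nbr_converse.
  have : \sum_(x in A) #|nbr (converse e) A x| <= \sum_(x in A) d.-1.
    by apply: leq_sum => x /sm; lia.
  rewrite !sum_nat_const; nia.
(* strict, because v is neither in S nor an in-neighbour of itself *)
have disj S : S \subset A -> (forall y, y \in S -> ~~ e y v && (y != v)) ->
    #|S| + d < #|A|.
  move=> SA out; apply: leq_ltn_trans (_ : #|S :|: nbr (converse e) A v| < _).
    rewrite cardsU (_ : _ :&: _ = set0) ?cards0 ?subn0 ?leq_add2l //.
    apply/setP => y; rewrite in_setI in_nbr in_set0 /converse; apply/negP.
    by case/and3P => /out /andP[/negPf->].
  apply: proper_card; apply/properP; split; first by rewrite subUset SA nbr_sub.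
  exists v => //; rewrite in_setU in_nbr /converse negb_or; apply/andP; split.
    by apply/negP => /out; rewrite eqxx andbF.
  have /= := girth v 1; rewrite -/(walk e 1 v v) walk1 vA /=; apply; lia.
have [[w wA fl]|[S [SA wi cS]]] := flexible_or_ball (m - 2) d0 vA deg; last first.
  have : #|S| + d < #|A|.
    apply: disj => // y yS; have [l [l0 lm wl]] := wi y yS; apply/andP; split.
      have /negP nw : ~~ walk e l.+1 v v by apply: girth; lia.
      by apply/negP => eyv; apply: nw; apply: walk_rcons wl eyv.
    have nw : ~~ walk e l v v by apply: girth; lia.
    by apply: contraNneq nw => E; rewrite -{2}E.
  nia.
have T0 : 0 < T.
  by case: (T) num => //; rewrite !expn0; lia.
(* balls of radius at most T around w miss v and its in-neighbours *)
have small S i : S \subset A -> 0 < i <= T -> within e i S w -> #|S| + d < #|A|.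
  move=> SA iT wi; apply: disj => // y yS; have [l [l0 lm wl]] := wi y yS.
  apply/andP; split.
    have /negP nw : ~~ walk e l.+1 w v by apply: ret fl _; lia.
    by apply/negP => eyv; apply: nw; apply: walk_rcons wl eyv.
  have nw : ~~ walk e l w v by apply: ret fl _; lia.
  by apply: contraNneq nw => <-.
have [|||S [SA wi le]] := @sparse_grow_iter e m A d T w T _ d0 deg wA _ T0; [lia| |lia|].
  move=> S i SA iT wi B BS B0; apply: IH => //.
  have := small _ _ SA iT wi; have := subset_leq_card BS; lia.
have := small _ _ SA _ wi; rewrite T0 leqnn => /(_ isT).
move: le num; set a := m ^ T; set b := _ ^ T => le num.
have a0 : 0 < a by rewrite expn_gt0; lia.
have : a * (m * d) <= a * #|S| + d * a.
  apply: leq_trans le _; rewrite leq_add2l mulnA (mulnC b) (mulnC _ d) leq_mul2l num orbT //.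
rewrite (mulnC d a) -mulnDr leq_pmul2l //; lia.
Qed.

(** The integral form of an oriented graph with minimum semidegree more than
    |V|/k. *)
Definition dense_oriented k d e := [/\ forall x y, e x y -> ~~ e y x,
  forall x, d <= #|nbr e setT x|, forall x, d <= #|nbr (converse e) setT x| &
  #|V| < k * d].

Lemma dense_converse k d e : dense_oriented k d e -> dense_oriented k d (converse e).
Proof. by case=> [as_ o i c]; split=> // x y; apply: as_. Qed.

(** A ball around x and a ball into y that together exceed |V| intersect. *)
Lemma balls_meet e i j S S' x y : within e i S x -> within (converse e) j S' y ->
  #|V| < #|S| + #|S'| -> exists l, [/\ 1 < l, l <= i + j & walk e l x y].
Proof.
move=> wS wS' lt.
have [z] : exists z, z \in S :&: S'.
  apply/set0Pn; rewrite -card_gt0; have := cardsUI S S'.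
  have : #|S :|: S'| <= #|V| by apply: max_card.
  lia.
rewrite in_setI => /andP[/wS[l [l0 li wl]] /wS'[l' [l'0 l'j]]].
by rewrite walk_converse => wl'; exists (l + l'); split; [lia|lia|exact: walk_cat wl wl'].
Qed.

End Sparse.

(** * Short walks between all pairs of vertices *)

Section Engine.
Variable V : finType.
Implicit Types (e : rel V) (x y z v w : V) (A B S : {set V}).

Definition closed_free e t := forall x, ~~ walk e t x x.

Definition linked e r := forall x y, exists l, [/\ 1 < l, l <= r & walk e l x y].

Lemma closed_free_converse e t : closed_free e t -> closed_free (converse e) t.
Proof. by move=> cf x; rewrite walk_converse. Qed.

Lemma closed_free_dvd e t l : closed_free e t -> l %| t -> closed_free e l.
Proof. by move=> cf dv x; apply: contra (cf x); apply: walk_dvd. Qed.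

Lemma linked_converse e r : linked e r -> linked (converse e) r.
Proof. by move=> li x y; have [l [? ? ?]] := li y x; exists l; rewrite walk_converse. Qed.

Lemma dense_pos k d e : V -> dense_oriented k d e -> 0 < d.
Proof.
move=> x [_ _ _]; have : 0 < #|V| by apply/card_gt0P; exists x.
by case: d => //; rewrite muln0; lia.
Qed.

Lemma dense_deg k d e y : dense_oriented k d e -> y \in [set: V] -> d <= #|nbr e setT y|.
Proof. by case=> _ o _ _ _; apply: o. Qed.

Lemma closed2 k d e : dense_oriented k d e -> closed_free e 2.
Proof.
move=> [as_ _ _ _] x; apply/negP => /(@walk_split _ e 1 1)[y].
by rewrite !walk1 => /as_/negPf->.
Qed.

Lemma closed1 k d e : dense_oriented k d e -> closed_free e 1.
Proof. by move=> /closed2 cf; apply: closed_free_dvd cf _. Qed.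

(** Lengths 1 and 2 are impossible in an oriented graph, the others divide t.
    *)
Lemma girth k d t e : dense_oriented k d e -> closed_free e t ->
  (forall i, 2 < i < k -> i %| t) ->
  forall v l, 0 < l < k -> ~~ walk e l v v.
Proof.
move=> de cf dv v [|[|[|l]]] // lk; first exact: (closed1 de).
  exact: (closed2 de).
by apply: (closed_free_dvd cf); apply: dv.
Qed.

Lemma no_return e t g r v w p : closable t g r -> closed_free e t ->
  flexible e g v w -> p <= r -> ~~ walk e p w v.
Proof.
by move=> cl cf fl pr; apply/negP => wp; have := closable_flexible cl fl wp pr; apply/negP/cf.
Qed.

Lemma dense_sparse k d t m T e : dense_oriented k d e -> closed_free e t ->
  (forall i, 2 < i < k -> i %| t) -> 1 < m < k ->
  m * m.-1 ^ T <= m ^ T -> closable t (m - 2) T.+1 -> sparse e m setT.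
Proof.
move=> de cf dv m1 num cl; apply: sparse_of num; first by case/andP: m1.
  by move=> v l lm; apply: (girth de cf dv); lia.
by move=> v w p fl pT; apply: no_return cl cf fl _; case/andP: pT.
Qed.

Lemma ball_iter k d m e x n : dense_oriented k d e -> 0 < m -> sparse e m setT -> 0 < n ->
  exists S, within e n S x /\ m ^ n * (m * d) <= m ^ n * #|S| + m.-1 ^ n * (m * d).
Proof.
move=> de m0 sp n0; have d0 := dense_pos x de.
have [||S [_ wi le]] := @sparse_grow_iter _ e m setT d n x n m0 d0 _ (in_setT x) _ n0 (leqnSn n).
- by move=> y; apply: dense_deg de.
- by move=> S i _ _ _ A _; apply: sp; apply: subsetT.
by exists S.
Qed.

(** Balls of radii i and j have sizes at least m d (1 - (1 - 1/m)^i) and m d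
    (1 - (1 - 1/m)^j); the numerical hypothesis says that the sum is at least
    k d. *)
Lemma linked_num k d m i j e : dense_oriented k d e -> 0 < m ->
  sparse e m setT -> sparse (converse e) m setT -> 0 < i -> 0 < j ->
  k * m ^ (i + j) + m * m.-1 ^ i * m ^ j + m * m ^ i * m.-1 ^ j <= 2 * m * m ^ (i + j) ->
  linked e (i + j).
Proof.
move=> de m0 sp spr i0 j0 num x y; have d0 := dense_pos x de.
have [S [wS le]] := ball_iter x de m0 sp i0.
have [S' [wS' le']] := ball_iter y (dense_converse de) m0 spr j0.
apply: balls_meet wS wS' _; case: de => _ _ _ lt.
move: num le le'; rewrite expnD.
have : 0 < m ^ i * m ^ j by rewrite muln_gt0 !expn_gt0 m0.
set a := m ^ i; set b := m ^ j; set a' := _ ^ i; set b' := _ ^ j => ab0 num le le'.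
have h1 : b * (a * (m * d)) <= b * (a * #|S| + a' * (m * d)) by rewrite leq_mul2l le orbT.
have h2 : a * (b * (m * d)) <= a * (b * #|S'| + b' * (m * d)) by rewrite leq_mul2l le' orbT.
have h3 : d * (k * (a * b) + m * a' * b + m * a * b') <= d * (2 * m * (a * b)).
  by rewrite leq_mul2l num orbT.
have : (a * b) * (k * d) <= (a * b) * (#|S| + #|S'|) by nia.
rewrite leq_pmul2l //; apply: leq_trans lt.
Qed.

(** If no ball of radius h around x had h d vertices, x would start an (h -
    1)-flexible pair, and a return of length at most r would close it. *)
Lemma ball_or_return k d t h r e x : dense_oriented k d e -> closed_free e t ->
  0 < h -> closable t h.-1 r -> linked e r ->
  exists S, within e h S x /\ h * d <= #|S|.
Proof.
move=> de cf h0 cl li; have d0 := dense_pos x de.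
have dg y : y \in [set: V] -> d <= #|nbr e setT y| by apply: dense_deg de.
have [[w _ fl]|[S [_ wi le]]] := flexible_or_ball h.-1 d0 (in_setT x) dg.
  have [l [_ lr wl]] := li w x.
  by have := no_return cl cf fl lr; rewrite wl.
by exists S; rewrite prednK // in wi le.
Qed.

(** This improves a weak bound r on the distances to h + h', which can be as
    small as k. *)
Lemma linked_half k d t h h' r e : dense_oriented k d e -> closed_free e t ->
  0 < h -> 0 < h' -> k <= h + h' ->
  closable t h.-1 r -> closable t h'.-1 r -> linked e r -> linked e (h + h').
Proof.
move=> de cf h0 h'0 kh cl cl' li x y.
have [S [wS le]] := ball_or_return x de cf h0 cl li.
have [S' [wS' le']] := ball_or_return y (dense_converse de) (closed_free_converse cf) h'0 cl' (linked_converse li).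
apply: balls_meet wS wS' _; case: de => _ _ _ lt; nia.
Qed.

(** A ball of size k d does not exist. *)
Lemma flexible_everywhere k d t r e x : dense_oriented k d e -> closed_free e t ->
  0 < k -> linked e r -> exists w, flexible e k.-1 x w.
Proof.
move=> de cf k0 li; have d0 := dense_pos x de.
have dg y : y \in [set: V] -> d <= #|nbr e setT y| by apply: dense_deg de.
have [[w _ fl]|[S [_ wi le]]] := flexible_or_ball k.-1 d0 (in_setT x) dg; first by exists w.
have := max_card S; case: de => _ _ _; rewrite prednK // in le; lia.
Qed.

Lemma linked_closable_absurd k d t r e x : dense_oriented k d e -> closed_free e t ->
  0 < k -> linked e r -> closable t k.-1 r -> False.
Proof.
move=> de cf k0 li cl; have [w fl] := flexible_everywhere x de cf k0 li.
have [l [_ lr wl]] := li w x.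
by have := no_return cl cf fl lr; rewrite wl.
Qed.

Lemma linked_sparse k d t m T i j e : dense_oriented k d e -> closed_free e t ->
  (forall l, 2 < l < k -> l %| t) -> 1 < m < k ->
  m * m.-1 ^ T <= m ^ T -> closable t (m - 2) T.+1 -> 0 < i -> 0 < j ->
  k * m ^ (i + j) + m * m.-1 ^ i * m ^ j + m * m ^ i * m.-1 ^ j <= 2 * m * m ^ (i + j) ->
  linked e (i + j).
Proof.
move=> de cf dv mk num cl i0 j0 num'; apply: linked_num num' => //.
- exact: de.
- by case/andP: mk; lia.
- exact: dense_sparse de cf dv mk num cl.
exact: dense_sparse (dense_converse de) (closed_free_converse cf) dv mk num cl.
Qed.

End Engine.

(** This is (1 - 1/m)^m <= 1/2, from the Bernoulli inequality. *)
Lemma expn_half m : 0 < m -> 2 * m.-1 ^ m <= m ^ m.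
Proof.
case: m => // m _; rewrite [_.-1]/=; have [->|m0] := posnP m; first by [].
have b n : m ^ n * (m + n) <= m * m.+1 ^ n.
  elim: n => [|n IH]; first by rewrite !expn0; lia.
  rewrite !expnS; set a := m ^ n in IH *; set c := m.+1 ^ n in IH *.
  have : m.+1 * (a * (m + n)) <= m.+1 * (m * c) by rewrite leq_mul2l IH orbT.
  nia.
have := b m.+1; rewrite [m ^ _]expnS -mulnA leq_pmul2l //; nia.
Qed.

(** * Closed walks for k = 7, 8, 9, 11 and for large k *)

(** The entry of index i tells whether n - i is a sum of members of X. *)
Fixpoint span_table (X : seq nat) n : seq bool :=
  if n is n'.+1 then
    let T := span_table X n' in
    has (fun x => (0 < x) && nth false T x.-1) X :: T
  else [:: true].

Lemma span_tableP L X n i : sum_closed L -> (forall x, x \in X -> L x) ->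
  nth false (span_table X n) i -> n = i \/ i < n /\ L (n - i).
Proof.
move=> add LX; elim: n i => [|n IH] [|i] //=; first by left.
- by rewrite nth_nil.
- case/hasP => x xX /andP[x0 /IH[E|[xn Ln]]]; right; split=> //.
    by have -> : n.+1 - 0 = x by [lia]; apply: LX.
  have -> : n.+1 - 0 = x + (n - x.-1) by lia.
  by apply: add => //; apply: LX.
by case/IH => [->|[? ?]]; [left|right; rewrite subSS].
Qed.

(** Branches over the next member of L, which lies at most g beyond the last
    known one r, until t becomes a sum of known members. *)
Fixpoint window_search f g t X r : bool :=
  if head false (span_table X t) then true else
  if f is f'.+1 then
    all (fun d => window_search f' g t (r + d :: X) (r + d)) (iota 1 g)
  else false.

Lemma window_searchP L f g t X r : sum_closed L -> 0 < t ->
  (forall N, r <= N -> exists l, [/\ N < l, l <= N + g & L l]) ->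
  (forall x, x \in X -> L x) -> window_search f g t X r -> L t.
Proof.
move=> add t0; have tab Y : (forall x, x \in Y -> L x) ->
    head false (span_table Y t) -> L t.
  by move=> LY; rewrite -nth0 => /(span_tableP add LY)[|[_]]; [lia|rewrite subn0].
elim: f X r => [|f IH] X r win LX /=; first by case: ifP => // /(tab _ LX).
case: ifP => [/(tab _ LX)//|_].
have [l [rl lg Ll]] := win r (leqnn r).
move/allP => /(_ (l - r)); rewrite mem_iota subnKC ?(ltnW rl) // => ws.
apply: (IH (l :: X) l); [|move=> x|by apply: ws; lia].
  by move=> N lN; apply: win; lia.
by rewrite inE => /orP[/eqP->|/LX].
Qed.

(** Here (11 + 3)(11 + 3 + 3 - 2) exceeds 60, so the size criterion fails, but
    the finitely many ways to hit the windows can be enumerated. *)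
Lemma closable60 : closable 60 3 11.
Proof.
move=> L add win; apply: (window_searchP (f := 60) (t := 60) (X := [::]) add isT win).
  by [].
by vm_compute.
Qed.

Lemma closable60_full L : sum_closed L ->
  (forall N, 7 <= N -> exists l, [/\ N < l, l <= N + 6 & L l]) ->
  L 7 \/ L 8 -> L 60.
Proof.
have one x : L x -> forall y, y \in [:: x] -> L y by move=> Lx y; rewrite inE => /eqP->.
move=> add win [L7|L8].
  apply: (window_searchP (f := 60) (t := 60) (X := [:: 7]) add isT win (one _ L7)).
  by vm_compute.
apply: (window_searchP (f := 60) (t := 60) (X := [:: 8]) add isT win (one _ L8)).
by vm_compute.
Qed.

Lemma dvdn_all k t : 4 < k -> (forall i, 2 < i < k -> i %| t) ->
  forall i, 0 < i -> i < k -> i %| t.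
Proof.
move=> k4 dv i i0 ik; have [i2|] := ltnP 2 i; first by apply: dv; rewrite i2.
have d4 : 4 %| t by apply: dv; lia.
by case: i i0 ik => [|[|[|i]]] // _ _ _; apply: dvdn_trans d4.
Qed.

Section Large.
Variable V : finType.
Implicit Types (e : rel V) (x y z v w : V) (A B S : {set V}).

Ltac closable_by_size := apply: closableP => //; case=> [|[|[|[|[|[|[|[|[|[|[|?]]]]]]]]]]]; lia.

(** The bound 60 is so small that the last step also needs the closed walk of
    length 7 or 8 through every vertex, which exists because distances are at
    most 7 and the girth is at least 7. *)
Lemma dense7_closed60 d e x : dense_oriented 7 d e -> closed_free e 60 -> False.
Proof.
move=> de cf.
have dv l : 2 < l < 7 -> l %| 60 by case: l => [|[|[|[|[|[|[|l]]]]]]].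
have li11 : linked e (5 + 6).
  (* m = 5 and T = 8, as (4/5)^8 <= 1/5; radii 5 and 6 suffice for k = 7 *)
  have c : closable 60 (5 - 2) 9 by apply: closable_mono closable60.
  have n1 : 5 * 4 ^ 8 <= 5 ^ 8 by lia.
  have n2 : 7 * 5 ^ (5 + 6) + 5 * 4 ^ 5 * 5 ^ 6 + 5 * 5 ^ 5 * 4 ^ 6
            <= 2 * 5 * 5 ^ (5 + 6) by lia.
  exact: (linked_sparse (m := 5) (T := 8) (i := 5) (j := 6) de cf dv isT n1 c isT isT n2).
(* balls of radii 4 and 3 *)
have li7 : linked e 7.
  have c3 := closable60; have c2 : closable 60 2 11 by apply: closable_mono closable60.
  exact: (linked_half (h := 4) (h' := 3) de cf _ _ _ c3 c2 li11).
have [w fl] := flexible_everywhere x de cf isT li7.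
have [l [_ l7 wl]] := li7 w x.
apply/negP: (cf x); rewrite negbK.
apply: (closable60_full (L := fun l => walk e l x x)).
- by move=> a b; apply: walk_cat.
- move=> N N7; have [l' [h1 h2 wl']] := fl (N - l).
  by exists (l' + l); split; [lia|lia|exact: walk_cat wl' wl].
have [y exy] : exists y, e x y.
  have d0 := dense_pos x de; have [_ o _ _] := de.
  have /card_gt0P[y] : 0 < #|nbr e setT x| by apply: leq_trans (o x).
  by rewrite in_nbr => /andP[_]; exists y.
have [j [j1 j7 wj]] := li7 y x.
have wc : walk e j.+1 x x := walkS exy wj.
have : ~~ (j.+1 < 7).
  by apply/negP => j6; move: wc; apply/negP/(girth de cf dv); lia.
move=> j6; have [E|E] : j.+1 = 7 \/ j.+1 = 8 by lia.
  by left; rewrite -E.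
by right; rewrite -E.
Qed.

(** Distances at most 15 come from sparseness with m = 5, and then distances
    at most 8 from balls of radius 4. *)
Lemma dense8_closed420 d e x : dense_oriented 8 d e -> closed_free e 420 -> False.
Proof.
move=> de cf.
have dv l : 2 < l < 8 -> l %| 420 by case: l => [|[|[|[|[|[|[|[|l]]]]]]]].
have li15 : linked e (7 + 8).
  (* m = 5 and T = 8, as (4/5)^8 <= 1/5; radii 7 and 8 suffice for k = 8 *)
  have c : closable 420 (5 - 2) 9 by closable_by_size.
  have n1 : 5 * 4 ^ 8 <= 5 ^ 8 by lia.
  have n2 : 8 * 5 ^ (7 + 8) + 5 * 4 ^ 7 * 5 ^ 8 + 5 * 5 ^ 7 * 4 ^ 8
            <= 2 * 5 * 5 ^ (7 + 8) by lia.
  exact: (linked_sparse (m := 5) (T := 8) (i := 7) (j := 8) de cf dv isT n1 c isT isT n2).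
have li8 : linked e 8.
  have c3 : closable 420 3 15 by closable_by_size.
  exact: (linked_half (h := 4) (h' := 4) de cf _ _ _ c3 c3 li15).
by apply: (linked_closable_absurd x de cf _ li8) => //; closable_by_size.
Qed.

Lemma dense9_closed840 d e x : dense_oriented 9 d e -> closed_free e 840 -> False.
Proof.
move=> de cf.
have dv l : 2 < l < 9 -> l %| 840 by case: l => [|[|[|[|[|[|[|[|[|l]]]]]]]]].
have li : linked e (7 + 7).
  (* m = 8 and T = 16, as (7/8)^16 <= 1/8; radii 7 and 7 suffice for k = 9 *)
  have c : closable 840 (8 - 2) 17 by closable_by_size.
  have n1 : 8 * 7 ^ 16 <= 8 ^ 16 by lia.
  have n2 : 9 * 8 ^ (7 + 7) + 8 * 7 ^ 7 * 8 ^ 7 + 8 * 8 ^ 7 * 7 ^ 7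
            <= 2 * 8 * 8 ^ (7 + 7) by lia.
  exact: (linked_sparse (m := 8) (T := 16) (i := 7) (j := 7) de cf dv isT n1 c isT isT n2).
by apply: (linked_closable_absurd x de cf _ li) => //; closable_by_size.
Qed.

Lemma dense11_closed2520 d e x : dense_oriented 11 d e -> closed_free e 2520 -> False.
Proof.
move=> de cf.
have dv l : 2 < l < 11 -> l %| 2520.
  by case: l => [|[|[|[|[|[|[|[|[|[|[|l]]]]]]]]]]].
have li : linked e (8 + 8).
  (* m = 10 and T = 22, as (9/10)^22 <= 1/10; radii 8 and 8 suffice *)
  have c : closable 2520 (10 - 2) 23 by closable_by_size.
  have n1 : 10 * 9 ^ 22 <= 10 ^ 22 by lia.
  have n2 : 11 * 10 ^ (8 + 8) + 10 * 9 ^ 8 * 10 ^ 8 + 10 * 10 ^ 8 * 9 ^ 8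
            <= 2 * 10 * 10 ^ (8 + 8) by lia.
  exact: (linked_sparse (m := 10) (T := 22) (i := 8) (j := 8) de cf dv isT n1 c isT isT n2).
by apply: (linked_closable_absurd x de cf _ li) => //; closable_by_size.
Qed.

(** Taking m = k - 1, radii m s and 2m suffice since (1 - 1/m)^m <= 1/2: the
    first makes (1 - 1/m)^(m s) <= 1/m, the second makes two balls of at least
    3/4 m d vertices each. *)
Lemma dense_large_closed k d t s e x : dense_oriented k d e -> closed_free e t -> 0 < t ->
  (forall i, 2 < i < k -> i %| t) -> 12 < k -> k.-1 <= 2 ^ s -> 3 < s ->
  k.-1 ^ 2 * (s.+1 * s.+2) <= t -> False.
Proof.
move=> de cf t0 dv k12 ks s4 big.
have dv' := dvdn_all (ltn_trans (isT : 4 < 12) k12) dv.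
set m := k.-1 in ks big; have Ek : k = m.+1 by rewrite /m; lia.
have m11 : 11 < m by rewrite /m; lia.
clearbody m; subst k.
have hm : 2 * m.-1 ^ m <= m ^ m by apply: expn_half; lia.
have cl g r : g <= m -> (r + g) * (r + g + g - 2) <= t -> closable t g r.
  by move=> gm le; apply: closableP => // i i0 ig; apply: dv'; lia.
have pw n : 2 ^ n * m.-1 ^ (m * n) <= m ^ (m * n).
  by rewrite !expnM -expnMn; case: (n) => [|n'] //; rewrite leq_exp2r.
have li : linked e (2 * m + 2 * m).
  apply: (@linked_sparse _ m.+1 d t m (m * s) (2 * m) (2 * m) e) => //; try lia.
  - apply: leq_trans (pw s); exact: leq_mul.
  - apply: cl; first lia.
    apply: leq_trans big; rewrite expnS expn1 mulnACA; apply: leq_mul; lia.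
  have := pw 2; rewrite (mulnC 2 m) expnD.
  set a := m ^ _; set b := m.-1 ^ _ => le.
  have : m * (4 * (b * a)) <= m * (a * a) by rewrite leq_mul2l mulnA leq_mul2r le !orbT.
  have : 12 * (a * a) <= m * (a * a) by rewrite leq_mul2r m11 orbT.
  rewrite -!mulnA (mulnC a b); move: (a * a) (b * a) => p q; nia.
apply: (linked_closable_absurd x de cf _ li); first lia.
apply: cl; first lia.
apply: leq_trans big; rewrite expnS expn1 mulnACA; apply: leq_mul; nia.
Qed.

End Large.

(** * The size of common multiples, and closed walks for k at least 6 *)

Lemma dvdn_coprime_mul a b t : coprime a b -> a %| t -> b %| t -> a * b %| t.
Proof. by move=> co da db; rewrite Gauss_dvd // da. Qed.

(** The largest powers of 2, 3, 5, 7 and 11 that do not exceed m are coprime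
    divisors of t, and each prime p times its power exceeds m. *)
Lemma common_multiple_large m t : 0 < m -> 0 < t ->
  (forall i, 0 < i -> i <= m -> i %| t) -> m.+1 ^ 5 <= 2 * 3 * 5 * 7 * 11 * t.
Proof.
move=> m0 t0 dv.
have pw p : 1 < p -> m.+1 <= p * p ^ trunc_log p m /\ p ^ trunc_log p m %| t.
  move=> p1; have /andP[le lt] := trunc_log_bounds p1 m0.
  by split; [rewrite -expnS|apply: dv; rewrite ?expn_gt0; lia].
have cop p q i j : coprime p q -> coprime (p ^ i) (q ^ j).
  by move=> co; apply/coprimeXl/coprimeXr.
have [l2 d2] := pw 2 isT; have [l3 d3] := pw 3 isT; have [l5 d5] := pw 5 isT.
have [l7 d7] := pw 7 isT; have [l11 d11] := pw 11 isT.
pose P := 2 ^ trunc_log 2 m * 3 ^ trunc_log 3 m * 5 ^ trunc_log 5 m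
  * 7 ^ trunc_log 7 m * 11 ^ trunc_log 11 m.
have dP : P %| t.
  by rewrite /P !Gauss_dvd ?coprimeMl ?cop // d2 d3 d5 d7 d11.
have leP := dvdn_leq t0 dP.
apply: leq_trans (leq_mul (leqnn _) leP); rewrite /P.
have -> : m.+1 ^ 5 = m.+1 * m.+1 * m.+1 * m.+1 * m.+1 by rewrite !expnS expn0; lia.
move: (2 ^ _) (3 ^ _) (5 ^ _) (7 ^ _) (11 ^ _) l2 l3 l5 l7 l11 => a b c d e la lb lc ld le.
have -> : 2 * 3 * 5 * 7 * 11 * (a * b * c * d * e)
  = (2 * a) * (3 * b) * (5 * c) * (7 * d) * (11 * e) by lia.
by do !apply: leq_mul.
Qed.

(** The exponent m/8 + 1 is far above the logarithm of m but small enough for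
    a common multiple of order m^5. *)
Lemma log_exponent m : 64 < m ->
  exists s, [/\ 3 < s, m <= 2 ^ s &
    2 * 3 * 5 * 7 * 11 * (m ^ 2 * (s.+1 * s.+2)) <= m.+1 ^ 5].
Proof.
move=> m64; exists (m %/ 8).+1.
have := divn_eq m 8; have : m %% 8 < 8 by rewrite ltn_mod.
set q := m %/ 8; move=> r8 E; have q8 : 7 < q by lia.
split; first lia.
  have : 8 * q.+1 <= 2 ^ q.+1.
    elim: (q) q8 => // n IH n7; have [->|n8] := eqVneq n 7; first by [].
    by have := IH ltac:(lia); rewrite !(expnS 2 n.+1); lia.
  lia.
have -> : m.+1 ^ 5 = m.+1 ^ 2 * m.+1 ^ 3 by rewrite -expnD.
rewrite mulnCA; apply: leq_mul; first by rewrite leq_exp2r.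
apply: leq_trans (_ : (8 * q) ^ 3 <= _); last by rewrite leq_exp2r //; lia.
rewrite !expnS expn0; nia.
Qed.

Section Large.
Variable V : finType.
Implicit Types (e : rel V).

(** Only prime powers k occur: 6, 10 and 12 are products of coprime numbers
    that divide t. For 13 <= k <= 65 it is enough that t is a multiple of
    27720, or of 360360 when 13 divides t. *)
Lemma dense_ge6_closed k d t e (x : V) : dense_oriented k d e -> closed_free e t -> 0 < t ->
  (forall i, 2 < i < k -> i %| t) -> 5 < k -> ~~ (k %| t) -> False.
Proof.
move=> de cf t0 dv k5 ndv.
have dv' := dvdn_all (ltnW k5) dv.
have div i : 0 < i < k -> i %| t by case/andP; apply: dv'.
have mul a b : coprime a b -> a %| t -> b %| t -> a * b %| t := @dvdn_coprime_mul a b t.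
have free s : s %| t -> closed_free e s by apply: closed_free_dvd.
have [k13|k12] := ltnP 12 k; last first.
  have d3 : 3 %| t by apply: div; lia.
  have d4 : 4 %| t by apply: div; lia.
  have d5 : 5 %| t by apply: div; lia.
  have d60 : 60 %| t by apply: (mul 12 5) => //; apply: (mul 3 4).
  have [E|k7] := eqVneq k 6.
    by move: ndv; rewrite E (dvdn_trans _ d60).
  have [E|k8] := eqVneq k 7; first by subst k; apply: (dense7_closed60 x de (free _ d60)).
  have d7 : 7 %| t by apply: div; lia.
  have [E|k9] := eqVneq k 8.
    by subst k; apply: (dense8_closed420 x de (free _ _)); apply: (mul 60 7).
  have d8 : 8 %| t by apply: div; lia.
  have d105 : 105 %| t by apply: (mul 15 7) => //; apply: (mul 3 5).
  have [E|k10] := eqVneq k 9.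
    by subst k; apply: (dense9_closed840 x de (free _ _)); apply: (mul 105 8).
  have d9 : 9 %| t by apply: div; lia.
  have [E|k11] := eqVneq k 10.
    by move: ndv; rewrite E (dvdn_trans _ d60).
  have [E|kN11] := eqVneq k 11.
    subst k; apply: (dense11_closed2520 x de (free _ _)).
    apply: (mul 280 9) => //; apply: (mul 35 8) => //; exact: (mul 5 7).
  have E : k = 12 by lia.
  by move: ndv; rewrite E (dvdn_trans _ d60).
have big s : k.-1 <= 2 ^ s -> 3 < s -> k.-1 ^ 2 * (s.+1 * s.+2) <= t -> False.
  by apply: (dense_large_closed x de cf).
have d9 : 9 * 11 %| t by apply: mul => //; apply: div; lia.
have d99 : 9 * 11 * 7 %| t by apply: mul => //; apply: div; lia.
have dP : 9 * 11 * 7 * (5 * 8) %| t by apply: (mul (9 * 11 * 7) (5 * 8)) => //; apply: (mul 5 8) => //; apply: div; lia.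
have [E|k14] := eqVneq k 13.
  apply: (big 6) => //; rewrite E //=.
  apply: leq_trans (dvdn_leq t0 dP); lia.
have [k65|k66] := leqP k 65.
  apply: (big 6) => //; first by rewrite (leq_trans (_ : _ <= 64)) //; lia.
  have dQ : 9 * 11 * 7 * 13 * (5 * 8) %| t.
    apply: (mul (9 * 11 * 7 * 13) (5 * 8)) => //; last by apply: (mul 5 8) => //; apply: div; lia.
    by apply: (mul (9 * 11 * 7) 13) => //; apply: div; lia.
  apply: leq_trans (dvdn_leq t0 dQ).
  have : k.-1 ^ 2 <= 64 ^ 2 by rewrite leq_exp2r //; lia.
  set u := _ ^ 2; lia.
have [|s [s3 ms num]] := @log_exponent k.-1; first lia.
apply: (big s) => //.
have le : k.-1.+1 ^ 5 <= 2 * 3 * 5 * 7 * 11 * t.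
  by apply: common_multiple_large => //; [lia|move=> i i0 ik; apply: div; lia].
have := leq_trans num le; by rewrite leq_pmul2l.
Qed.

End Large.

(** * Closed walks for k = 3, and shortcuts for the types 1, 2 and 3 *)

Section Small.
Variable V : finType.
Implicit Types (e : rel V) (x y z v w : V) (A B S : {set V}).

Notation out e x := (nbr e setT x).

Lemma in_out e x y : (y \in out e x) = e x y.
Proof. by rewrite in_nbr in_setT. Qed.

Lemma dense_out k d e x : dense_oriented k d e -> d <= #|out e x|.
Proof. by case. Qed.

Lemma dense_in k d e x : dense_oriented k d e -> d <= #|out (converse e) x|.
Proof. by case. Qed.

Lemma dense_pack k d e (s : seq {set V}) : dense_oriented k d e -> size s = k ->
  pairwise (fun A B => [disjoint A & B]) s -> all (fun A => d <= #|A|) s -> False.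
Proof. by move=> [_ _ _ lt] sz dis big; have := disjoint_card dis big; rewrite sz; lia. Qed.

Lemma dense_next k d e x : dense_oriented k d e -> exists y, e x y.
Proof.
move=> de; have d0 := dense_pos x de.
have /card_gt0P[y] := leq_trans d0 (dense_out x de).
by rewrite in_out; exists y.
Qed.

Lemma dense_back k d e x n : dense_oriented k d e -> exists w, walk e n w x.
Proof.
move=> de; elim: n => [|n [w ww]]; first by exists x; rewrite walk0.
by have [y eyw] := dense_next w (dense_converse de); exists y; apply: (@walkS _ e) eyw ww.
Qed.

Lemma walk2 e x y z : e x y -> e y z -> walk e 2 x z.
Proof. by move=> exy eyz; apply: walkS exy _; rewrite walk1. Qed.

Lemma walk3 e x y z u : e x y -> e y z -> e z u -> walk e 3 x u.
Proof. by move=> exy eyz ezu; apply: walkS exy (walk2 eyz ezu). Qed.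

Lemma no_edge2 k d e x y : dense_oriented k d e -> e x y -> e y x -> False.
Proof. by case=> as_ _ _ _ /as_/negP. Qed.

Lemma sink_out k d t r e x : dense_oriented k d e -> closed_free e t -> linked e r ->
  r < t -> exists y, e x y /\ forall z, e x z -> ~~ e y z.
Proof.
move=> de cf li rt; have [y0 exy0] := dense_next x de.
have S0 : out e x != set0 by apply/set0Pn; exists y0; rewrite in_out.
have [[y ys sink]|[w _ fl]] := sink_or_flexible S0 (@within_nbr _ e setT x).
  by exists y; rewrite -in_out; split=> // z; rewrite -in_out; apply: sink.
have [l [_ lr wl]] := li w x.
by have := no_return (closable1 rt) cf fl lr; rewrite wl.
Qed.

Lemma transitive_triangle3 d e x : dense_oriented 3 d e ->
  exists u v w, [/\ e u v, e v w & e u w].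
Proof.
move=> de; have [y exy] := dense_next x de.
case: (boolP [exists u, exists v, exists w, [&& e u v, e v w & e u w]]).
  by case/existsP=> u /existsP[v /existsP[w /and3P[? ? ?]]]; exists u, v, w.
rewrite negb_exists => /forallP no; exfalso.
have {}no u v w : e u v -> e v w -> e u w -> False.
  move=> euv evw euw; move: (no u); rewrite negb_exists => /forallP/(_ v).
  by rewrite negb_exists => /forallP/(_ w); rewrite euv evw euw.
apply: (dense_pack (s := [:: out e x; out e y; out (converse e) y]) de) => //=; last first.
  by rewrite !(dense_out _ de) (dense_in _ de).
rewrite !andbT; apply/andP; split; first (apply/andP; split).
all: apply: disjoint_by => z; rewrite !in_out /converse.
- by move=> exz eyz; apply: (no x y z).
- by move=> exz ezy; apply: (no x z y).
by move=> eyz ezy; apply: (no_edge2 de eyz).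
Qed.

Lemma transitive_triangle4 d e x : dense_oriented 4 d e -> closed_free e 3 ->
  exists u v w, [/\ e u v, e v w & e u w].
Proof.
move=> de cf; have [y exy] := dense_next x de.
case: (boolP [exists u, exists v, exists w, [&& e u v, e v w & e u w]]).
  by case/existsP=> u /existsP[v /existsP[w /and3P[? ? ?]]]; exists u, v, w.
rewrite negb_exists => /forallP no; exfalso.
have {}no u v w : e u v -> e v w -> e u w -> False.
  move=> euv evw euw; move: (no u); rewrite negb_exists => /forallP/(_ v).
  by rewrite negb_exists => /forallP/(_ w); rewrite euv evw euw.
apply: (dense_pack (s := [:: out e x; out e y; out (converse e) y; out (converse e) x]) de) => //=; last first.
  by rewrite !(dense_out _ de) !(dense_in _ de).
rewrite !andbT -!andbA; apply/and5P; split; last (apply/andP; split).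
all: apply: disjoint_by => z; rewrite !in_out /converse.
- by move=> exz eyz; apply: (no x y z).
- by move=> exz ezy; apply: (no x z y).
- by move=> exz ezx; apply: (no_edge2 de exz).
- by move=> eyz ezy; apply: (no_edge2 de eyz).
- by move=> eyz ezx; have /negP := cf x; apply; apply: walk3 exy eyz ezx.
by move=> ezy ezx; apply: (no z x y).
Qed.

Lemma shortcut2 d e x : dense_oriented 3 d e -> exists u v, e u v /\ walk e 2 u v.
Proof.
move=> /(transitive_triangle3 x)[u [v [w [euv evw euw]]]].
by exists u, w; split=> //; apply: walk2 euv evw.
Qed.

(** Otherwise, for a transitive triangle u, a, b, the sets N+(u), N+(b) and
    N-(a) would be pairwise disjoint. *)
Lemma shortcut3 d e x : dense_oriented 3 d e -> exists u v, e u v /\ walk e 3 u v.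
Proof.
move=> de; have [u [a [b [eua eab eub]]]] := transitive_triangle3 x de.
case: (boolP [exists u, exists v, e u v && walk e 3 u v]).
  by case/existsP=> p /existsP[q /andP[? ?]]; exists p, q.
rewrite negb_exists => /forallP no; exfalso.
have {}no p q : e p q -> walk e 3 p q -> False.
  by move=> epq w; move: (no p); rewrite negb_exists => /forallP/(_ q); rewrite epq w.
apply: (dense_pack (s := [:: out e u; out e b; out (converse e) a]) de) => //=; last first.
  by rewrite !(dense_out _ de) !(dense_in _ de).
rewrite !andbT -!andbA; apply/and3P; split.
all: apply: disjoint_by => z; rewrite !in_out /converse.
- by move=> euz ebz; apply: (no u z) => //; apply: walk3 eua eab ebz.
- by move=> euz eza; apply: (no u b) => //; apply: walk3 euz eza eab.
by move=> ebz eza; apply: (no u a) => //; apply: walk3 eub ebz eza.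
Qed.

(** Inside N+(u) take a maximal path from a source a to a sink c; it has one
    or two arcs since three would give a shortcut. Inside N-(a) take a source
    v from which u is reached in at most two arcs. If there were no shortcut,
    N+(u), N+(c), N-(a) and N-(v) would be pairwise disjoint. *)
Lemma shortcut4 d e x : dense_oriented 4 d e -> closed_free e 3 ->
  exists u v, e u v /\ walk e 4 u v.
Proof.
move=> de cf; have [u [a0 [b0 [eua0 ea0b0 eub0]]]] := transitive_triangle4 x de cf.
case: (boolP [exists u, exists v, e u v && walk e 4 u v]).
  by case/existsP=> p /existsP[q /andP[? ?]]; exists p, q.
rewrite negb_exists => /forallP no4; exfalso.
have {}no4 p q r s v : e p v -> e p q -> e q r -> e r s -> e s v -> False.
  move=> epv epq eqr ers esv.
  move: (no4 p); rewrite negb_exists => /forallP/(_ v); rewrite epv /= => /negP; apply.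
  exact: walkS epq (walk3 eqr ers esv).
have no3 p q r : e p q -> e q r -> e r p -> False.
  by move=> epq eqr erp; have /negP := cf p; apply; apply: walk3 epq eqr erp.
have [a [c [eua euc src snk ac]]] : exists a c, [/\ e u a, e u c,
    forall z, e u z -> e z a -> False, forall z, e u z -> e c z -> False &
    e a c \/ exists b, [/\ e u b, e a b & e b c]].
  case: (boolP [exists z, e u z && e z a0]) => [/existsP[z /andP[euz eza0]]|].
    exists z, b0; split=> //; last by right; exists a0.
    - by move=> z' euz' ez'z; apply: (no4 u z' z a0 b0).
    - by move=> z' euz' eb0z'; apply: (no4 u z a0 b0 z').
  rewrite negb_exists => /forallP src0.
  have src z : e u z -> e z a0 -> False by move=> euz eza0; move: (src0 z); rewrite euz eza0.
  case: (boolP [exists z, e u z && e b0 z]) => [/existsP[z /andP[euz eb0z]]|].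
    exists a0, z; split=> //; last by right; exists b0.
    by move=> z' euz' ezz'; apply: (no4 u a0 b0 z z').
  rewrite negb_exists => /forallP snk0.
  exists a0, b0; split=> //; last by left.
  by move=> z euz eb0z; move: (snk0 z); rewrite euz eb0z.
have [v [eva srcv vu]] : exists v, [/\ e v a, forall z, e z a -> e z v -> False &
    v = u \/ e v u \/ exists w, [/\ e v w, e w u & e w a]].
  case: (boolP [exists z, e z a && e z u]) => [/existsP[z /andP[eza ezu]]|].
    case: (boolP [exists z', e z' a && e z' z]) => [/existsP[z' /andP[ez'a ez'z]]|].
      exists z'; split=> //; last by right; right; exists z.
      by move=> y eya eyz'; apply: (no4 y z' z u a).
    rewrite negb_exists => /forallP src0.
    exists z; split=> //; last by right; left.
    by move=> y eya eyz; move: (src0 y); rewrite eya eyz.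
  rewrite negb_exists => /forallP src0.
  exists u; split=> //; last by left.
  by move=> y eya eyu; move: (src0 y); rewrite eya eyu.
apply: (dense_pack (s := [:: out e u; out e c; out (converse e) a; out (converse e) v]) de) => //=; last first.
  by rewrite !(dense_out _ de) !(dense_in _ de).
rewrite !andbT -!andbA; apply/and5P; split; last (apply/andP; split).
all: apply: disjoint_by => z; rewrite !in_out /converse.
- exact: snk.
- exact: src.
- move=> euz ezv; case: vu => [E|[evu|[w [evw ewu ewa]]]].
  + by subst v; apply: (no_edge2 de euz ezv).
  + exact: (no3 u z v).
  + by apply: (no4 u z v w a).
- move=> ecz eza; case: ac => [eac|[b [eub eab ebc]]].
  + exact: (no3 a c z).
  + by apply: (no4 u b c z a).
- move=> ecz ezv; case: vu => [E|_]; first by subst v; apply: (no3 u c z).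
  by apply: (no4 u c z v a).
exact: srcv.
Qed.

Lemma closable0 t r : closable t 0 r.
Proof. by move=> L _ win; have [l [lt le _]] := win r (leqnn r); lia. Qed.

(** Let u, a, b be a transitive triangle. A walk from b to u of length t - 1
    or t - 2 would close up, so N+(b) and N+(y), for a sink y of N+(b), both
    avoid the vertices with a walk of length t - 3 to u. These are three
    disjoint sets of size d. *)
Lemma dense3_closed_ge5 d t e x : dense_oriented 3 d e -> closed_free e t -> 4 < t -> False.
Proof.
move=> de cf t5.
have dv l : 2 < l < 3 -> l %| t by lia.
have n1 : 2 * 1 ^ 1 <= 2 ^ 1 by [].
have n2 : 3 * 2 ^ (2 + 2) + 2 * 1 ^ 2 * 2 ^ 2 + 2 * 2 ^ 2 * 1 ^ 2 <= 2 * 2 * 2 ^ (2 + 2) by lia.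
have li : linked e 4.
  exact: (linked_sparse (m := 2) (T := 1) (i := 2) (j := 2) de cf dv isT n1 (@closable0 _ _) isT isT n2).
have [u [a [b [eua eab eub]]]] := transitive_triangle3 x de.
have [y [eby sink]] := sink_out b de cf li t5.
have [w ww] := dense_back u (t - 4) de.
apply: (dense_pack (s := [:: out e b; out e y; out (converse e) w]) de) => //=; last first.
  by rewrite !(dense_out _ de) !(dense_in _ de).
rewrite !andbT -!andbA; apply/and3P; split.
all: apply: disjoint_by => z; rewrite !in_out /converse.
- by move=> /sink/negP.
- move=> ebz ezw; have /negP := cf u; apply.
  have := walk_cat (walk2 eua eab) (walk_cat (walk2 ebz ezw) ww).
  by have -> : 2 + (2 + (t - 4)) = t by lia.
move=> eyz ezw; have /negP := cf u; apply.
have := walk_cat (walk2 eub eby) (walk_cat (walk2 eyz ezw) ww).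
by have -> : 2 + (2 + (t - 4)) = t by lia.
Qed.

Lemma subset_of_size (A : {set V}) (p q : V) n : p \in A -> q \in A -> 1 < n -> n <= #|A| ->
  exists X : {set V}, [/\ X \subset A, p \in X, q \in X & #|X| = n].
Proof.
move=> pA qA n1 nA.
have : exists m, exists X : {set V}, [/\ X \subset A, p \in X, q \in X & #|X| = n + m].
  by exists (#|A| - n), A; split=> //; lia.
case=> m; elim: m => [|m IH] [X [XA pX qX cX]]; first by exists X; rewrite addn0 in cX.
apply: IH; have [r] : exists r, r \in X :\: [set p; q].
  apply/set0Pn; rewrite -card_gt0 cardsD.
  have : #|X :&: [set p; q]| <= #|[set p; q]| by rewrite subset_leq_card // subsetIr.
  have := cards2 p q; case: (p != q); lia.
rewrite !inE negb_or => /andP[/andP[rp rq] rX].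
exists (X :\ r); split.
- exact: subset_trans (subD1set _ _) XA.
- by rewrite !inE eq_sym rp.
- by rewrite !inE eq_sym rq.
by have := cardsD1 r X; rewrite rX cX; lia.
Qed.

Lemma sparse2 k d e : dense_oriented k d e -> sparse e 2 setT.
Proof.
move=> de; apply: (@sparse_of _ e 2 1) => //; last by move=> v w p /(_ 0)[l [? ?]]; lia.
by move=> v [|[|[|l]]] // _; [apply: (closed1 de)|apply: (closed2 de)].
Qed.

(** Let u dominate an arc from p to q, and trim N+(u) and N-(u) to sets X
    (containing p, q) and Y of size d. Without closed 4-walk at u, the out-
    neighbours T of X and the in-neighbours S of Y are disjoint. A sparse
    vertex of X minus S sends its arcs to X minus S or to the part of T
    outside X and Y, and symmetrically for Y; adding up the sizes leaves no
    room in fewer than 3d vertices. *)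
Lemma dense3_closed4 d e x : dense_oriented 3 d e -> closed_free e 4 -> False.
Proof.
move=> de cf; have [u [p [q [eup epq euq]]]] := transitive_triangle3 x de.
have d1 : 1 < d.
  case: (de) => _ _ _; have := dense_pos x de.
  have : 2 < #|V|.
    apply: leq_trans (max_card [set u; p; q]); rewrite -setUA cardsU1 cards2 !inE negb_or.
    have ne y z : e y z -> y != z.
      by move=> eyz; apply: contraTneq eyz => ->; apply/negP => ezz; apply: (no_edge2 de ezz ezz).
    by rewrite !ne.
  lia.
have [X [XN pX qX cX]] : exists X : {set V}, [/\ X \subset out e u, p \in X, q \in X & #|X| = d].
  by apply: subset_of_size; rewrite ?in_out // (dense_out _ de).
have [r eru] := dense_next u (dense_converse de).
have [Y [YN rY _ cY]] : exists Y : {set V}, [/\ Y \subset out (converse e) u, r \in Y, r \in Y & #|Y| = d].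
  by apply: subset_of_size; rewrite ?in_out // (dense_in _ de).
have eX y : y \in X -> e u y by move/(subsetP XN); rewrite in_out.
have eY y : y \in Y -> e y u by move/(subsetP YN); rewrite in_out.
pose T := [set y | [exists z in X, e z y]]; pose S := [set y | [exists z in Y, e y z]].
have TP z y : z \in X -> e z y -> y \in T.
  by move=> zX ezy; rewrite inE; apply/exists_inP; exists z.
have SP z y : z \in Y -> e y z -> y \in S.
  by move=> zY eyz; rewrite inE; apply/exists_inP; exists z.
have TS y : y \in T -> y \in S -> False.
  rewrite !inE => /exists_inP[z zX ezy] /exists_inP[z' z'Y eyz'].
  have /negP := cf u; apply.
  exact: walkS (eX z zX) (walk3 ezy eyz' (eY z' z'Y)).
have XY y : y \in X -> y \in Y -> False.
  by move=> /eX euy /eY eyu; apply: (no_edge2 de euy eyu).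
pose ZT := T :\: (X :|: Y); pose ZS := S :\: (X :|: Y).
have sizes : #|ZT| + #|ZS| < d.
  case: (de) => _ _ _; suff : #|X| + #|Y| + (#|ZT| + #|ZS|) <= #|V| by rewrite cX cY; clear; lia.
  apply: leq_trans (max_card (X :|: Y :|: (ZT :|: ZS))).
  rewrite !cardsU.
  rewrite (_ : X :&: Y = set0); last first.
    by apply/eqP; rewrite setI_eq0; apply: disjoint_by.
  rewrite (_ : ZT :&: ZS = set0); last first.
    apply/eqP; rewrite setI_eq0; apply: disjoint_by => z; rewrite !inE.
    by case/andP=> _ zT /andP[_ zS]; apply: (TS z); rewrite inE.
  rewrite (_ : (X :|: Y) :&: (ZT :|: ZS) = set0) ?cards0; first by rewrite !subn0.
  apply/eqP; rewrite setI_eq0; apply: disjoint_by => z zXY; rewrite in_setU !in_setD zXY /=.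
  by [].
pose X1 := X :&: S; pose X2 := X :\: S; pose Y1 := Y :&: T; pose Y2 := Y :\: T.
have cXX : #|X1| + #|X2| = d by rewrite cardsID.
have cYY : #|Y1| + #|Y2| = d by rewrite cardsID.
have qX2 : q \in X2.
  by rewrite in_setD qX andbT; apply/negP; apply: TS; apply: TP epq.
(* from a vertex w of X2 with fewer than |X2|/2 out-neighbours in X2 *)
have hX2 : 2 * d < 2 * #|ZT| + #|X2|.
  have [|w wX2 lt] := sparse2 de (subsetT X2); first by apply/set0Pn; exists q.
  move: wX2; rewrite in_setD => /andP[wS wX].
  have : #|out e w| <= #|nbr e X2 w| + #|ZT|.
    apply: leq_trans (_ : #|nbr e X2 w :|: ZT| <= _); last by rewrite cardsU leq_subr.
    apply: subset_leq_card; apply/subsetP => z; rewrite in_out => ewz.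
    have zT : z \in T by apply: TP ewz.
    have zS : z \notin S by apply/negP; apply: TS.
    have zY : z \notin Y by apply: contra wS => zY; apply: SP ewz.
    rewrite in_setU in_nbr !in_setD in_setU zT zS (negPf zY) ewz orbF /=.
    by case: (z \in X).
  by move: (dense_out w de) lt; clear; lia.
(* if Y2 is empty, the in-neighbours of r lie in X1 or ZS *)
have [Y20|Y20] := eqVneq Y2 set0.
  have YT y : y \in Y -> y \in T.
    by move=> yY; apply: contraT => yT; have := in_set0 y; rewrite -Y20 in_setD yY yT.
  have : #|out (converse e) r| <= #|X1| + #|ZS|.
    apply: leq_trans (_ : #|X1 :|: ZS| <= _); last by rewrite cardsU leq_subr.
    apply: subset_leq_card; apply/subsetP => z; rewrite in_out => ezr.
    have zS : z \in S by apply: SP ezr.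
    have zT : z \notin T by apply/negP => zT; apply: (TS z).
    have zY : z \notin Y by apply: contra zT => /YT.
    by rewrite in_setU in_setI !in_setD in_setU zS (negPf zY) orbF andbT; case: (z \in X).
  by move: (dense_in r de) sizes cXX hX2; clear; lia.
have hY2 : 2 * d < 2 * #|ZS| + #|Y2|.
  have [w wY2 lt] := sparse2 (dense_converse de) (subsetT Y2) Y20.
  move: wY2; rewrite in_setD => /andP[wT wY].
  have : #|out (converse e) w| <= #|nbr (converse e) Y2 w| + #|ZS|.
    apply: leq_trans (_ : #|nbr (converse e) Y2 w :|: ZS| <= _); last by rewrite cardsU leq_subr.
    apply: subset_leq_card; apply/subsetP => z; rewrite in_out => ezw.
    have zS : z \in S by apply: SP ezw.
    have zT : z \notin T by apply/negP => zT; apply: (TS z).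
    have zX : z \notin X by apply: contra wT => zX; apply: TP ezw.
    rewrite in_setU in_nbr !in_setD in_setU zT zS (negPf zX) ezw /=.
    by case: (z \in Y).
  by move: (dense_in w de) lt; clear; lia.
by move: sizes cXX cYY hX2 hY2; clear; lia.
Qed.

End Small.

(** * Closed walks for k = 4 *)

Section Four.
Variable V : finType.
Implicit Types (e : rel V) (x y z v w : V) (A B S : {set V}).
Notation out e x := (nbr e setT x).

(** A finite form of 1-flexibility: all lengths up to t occur. *)
Definition forever e t b := [set w | [forall l : 'I_t.+1, (0 < l) ==> walk e l b w]].

Lemma foreverP e t b w : reflect (forall l, 0 < l -> l <= t -> walk e l b w) (w \in forever e t b).
Proof.
rewrite inE; apply: (iffP forallP) => [H l l0 lt|H l].
  by have := H (Ordinal (lt : l < t.+1)); rewrite /= l0.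
by apply/implyP => l0; apply: H => //; rewrite -ltnS.
Qed.

(** A return of length l < t could be completed by a walk of length t - l. *)
Lemma forever_far e t b w l : closed_free e t -> w \in forever e t b ->
  0 < l < t -> ~~ walk e l w b.
Proof.
move=> cf /foreverP fw lt; apply/negP => wl; have /negP := cf b; apply.
have := walk_cat (fw (t - l) _ _) wl; rewrite subnK; last lia.
by apply; lia.
Qed.

Lemma forever_sub e t b : 0 < t -> forever e t b \subset out e b.
Proof.
move=> t0; apply/subsetP => w /foreverP fw.
by rewrite in_out -(walk1 e) fw.
Qed.

Lemma forever_next e t b w z : w \in forever e t b -> e b z -> e w z ->
  z \in forever e t b.
Proof.
move=> /foreverP fw ebz ewz; apply/foreverP => -[|[|l]] // _ lt.
  by rewrite walk1.
by apply: walk_rcons ewz; apply: fw; lia.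
Qed.

(** If Y = forever e t b is empty, N+(b) has a sink w. Otherwise a sparse
    vertex w of Y wastes at most |Y|/3 out-neighbours, since its out-
    neighbours in N+(b) lie in Y. *)
Lemma forever_ball k d t e b : dense_oriented k d e -> 0 < t -> sparse e 3 setT ->
  exists S, within e 2 S b /\ 3 * #|out e b| + 3 * d <= 3 * #|S| + #|forever e t b|.
Proof.
move=> de t0 sp; set Y := forever e t b.
have S0 : out e b != set0.
  by have [y eby] := dense_next b de; apply/set0Pn; exists y; rewrite in_out.
suff [w [ebw cw]] : exists w, e b w /\ 3 * #|nbr e (out e b) w| <= #|Y|.
  exists (out e b :|: out e w); split.
    by apply: within_grow; [rewrite in_out|exact: within_nbr].
  rewrite cardsU.
  have -> : #|out e b :&: out e w| = #|nbr e (out e b) w|.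
    by apply: eq_card => z; rewrite in_setI !in_nbr !in_setT.
  have := dense_out w de.
  have : #|nbr e (out e b) w| <= #|out e b| by rewrite subset_leq_card // nbr_sub.
  by move: cw; clear; lia.
have [Y0|Y0] := eqVneq Y set0; last first.
  have [w wY lt] := sp Y (subsetT _) Y0; exists w; split.
    by rewrite -in_out; apply: (subsetP (forever_sub e b t0)).
  apply: leq_trans (ltnW lt); rewrite leq_mul2l /=; apply: subset_leq_card.
  apply/subsetP => z; rewrite !in_nbr in_setT /= => /andP[ebz ewz].
  by rewrite ewz andbT; apply: forever_next wY ebz ewz.
have [[y yS sink]|[w wS fl]] := sink_or_flexible S0 (@within_nbr _ e setT b).
  exists y; rewrite -in_out; split=> //.
  rewrite (_ : nbr _ _ _ = set0) ?cards0 ?muln0 //; apply/setP => z.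
  by rewrite in_nbr in_set0; apply/negP => /andP[/sink/negPf->].
have := in_set0 w; rewrite -Y0 => /negP[]; apply/foreverP => l l0 _.
have [l' [l1 l2 wl]] := fl l.-1.
by have <- : l' = l by [move: l0 l1 l2; clear; lia].
Qed.

Lemma far_grow k d e (Y S : {set V}) n : dense_oriented k d e -> sparse e 3 setT -> S != set0 ->
  (forall z, z \in S -> exists w l, [/\ w \in Y, l <= n & walk e l w z]) ->
  exists S', [/\ S' != set0, 2 * #|S| + 3 * d <= 3 * #|S'| &
    forall z, z \in S' -> exists w l, [/\ w \in Y, l <= n.+1 & walk e l w z]].
Proof.
move=> de sp S0 from; have [w wS lt] := sp S (subsetT _) S0.
exists (S :|: out e w); split.
- by apply/set0Pn; exists w; rewrite in_setU wS.
- exact: sparse_grow_card lt (dense_out w de).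
move=> z; rewrite in_setU in_out => /orP[/from[y [l [yY ln wl]]]|ewz].
  by exists y, l; split=> //; apply: leqW.
have [y [l [yY ln wl]]] := from w wS.
by exists y, l.+1; split=> //; apply: walk_rcons wl ewz.
Qed.

(** If Y = forever e t b is not empty, its vertices are at distance at least 6
    from b, so the ball of radius 3 around Y and the ball of radius 2 into b
    are disjoint. With sparseness for m = 3 they have more than 4d vertices,
    when Y is the larger one of Y and its analogue for the reversed arcs. *)
Lemma forever0 d t e b : dense_oriented 4 d e -> 5 < t -> closed_free e t ->
  sparse e 3 setT -> sparse (converse e) 3 setT ->
  #|forever (converse e) t b| <= #|forever e t b| -> forever e t b = set0.
Proof.
move=> de t5 cf sp spr; have t0 : 0 < t by lia.
set Y := forever e t b => UY; apply/eqP; apply/negPn/negP => Y0.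
have fr0 z : z \in Y -> exists w l, [/\ w \in Y, l <= 0 & walk e l w z].
  by move=> zY; exists z, 0; split=> //; rewrite walk0.
have [S1 [S10 c1 fr1]] := far_grow de sp Y0 fr0.
have [S2 [S20 c2 fr2]] := far_grow de sp S10 fr1.
have [S3 [_ c3 fr3]] := far_grow de sp S20 fr2.
have [P [wP cP]] := forever_ball b (dense_converse de) t0 spr.
have dis : [disjoint S3 & P].
  apply: disjoint_by => z /fr3[w [l [wY l3 wl]]] /wP[l' [l'0 l'2]].
  rewrite walk_converse => wl'; have := walk_cat wl wl'.
  by apply/negP/(forever_far cf wY); lia.
have : #|S3| + #|P| <= #|V|.
  have := max_card (S3 :|: P); rewrite cardsU (_ : S3 :&: P = set0) ?cards0 ?subn0 //.
  by apply/eqP; rewrite setI_eq0.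
have := dense_in b de; have : #|forever (converse e) t b| <= #|out (converse e) b|.
  by apply: subset_leq_card; apply: forever_sub.
case: (de) => _ _ _; move: c1 c2 c3 cP UY; clear; lia.
Qed.

Lemma ball_of_sink k d e x : dense_oriented k d e ->
  (exists y, e x y /\ forall z, e x z -> ~~ e y z) ->
  exists S, within e 2 S x /\ 2 * d <= #|S|.
Proof.
move=> de [y [exy sink]]; exists (out e x :|: out e y); split.
  by apply: within_grow; [rewrite in_out|exact: within_nbr].
rewrite cardsU (_ : _ :&: _ = set0) ?cards0 ?subn0; last first.
  by apply/eqP; rewrite setI_eq0; apply: disjoint_by => z; rewrite !in_out => /sink/negP.
by rewrite mul2n -addnn leq_add ?(dense_out _ de).
Qed.

(** Without a sink, N+(x) would contain the end of a 1-flexible pair. *)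
Lemma sink_of_forever0 k d t e x : dense_oriented k d e -> forever e t x = set0 ->
  exists y, e x y /\ forall z, e x z -> ~~ e y z.
Proof.
move=> de Y0; have [y0 exy0] := dense_next x de.
have S0 : out e x != set0 by apply/set0Pn; exists y0; rewrite in_out.
have [[y ys sink]|[w _ fl]] := sink_or_flexible S0 (@within_nbr _ e setT x).
  by exists y; rewrite -in_out; split=> // z; rewrite -in_out; apply: sink.
have := in_set0 w; rewrite -Y0 => /negP[]; apply/foreverP => l l0 _.
have [l' [l1 l2 wl]] := fl l.-1.
by have <- : l' = l by [move: l0 l1 l2; clear; lia].
Qed.

Lemma combination_4_5 t : 8 < t -> t != 11 -> exists a b, t = a * 4 + b * 5.
Proof.
move=> t8 t11; exists (t %/ 4 - t %% 4), (t %% 4).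
have := divn_eq t 4; have : t %% 4 < 4 by rewrite ltn_mod.
by move=> h E; move/eqP: t11; lia.
Qed.

Lemma cases_2_4 l : 1 < l -> l <= 4 -> l = 2 \/ l = 3 \/ l = 4.
Proof. by lia. Qed.

(** All neighbourhoods have sinks, so balls of radius 2 have 2d vertices and
    all distances are at most 4. A transitive triangle then yields closed
    walks of lengths 4 and 5 at one vertex, which settles every t except 6. *)
Lemma dense4_closed d t e x : dense_oriented 4 d e -> closed_free e t -> 3 %| t -> ~~ (4 %| t) ->
  5 < t -> False.
Proof.
move=> de cf t3 nt4 t5.
have cf3 : closed_free e 3 by apply: closed_free_dvd cf t3.
have dv l : 2 < l < 4 -> l %| t by move=> h; have -> : l = 3 by [lia].
have n1 : 3 * 2 ^ 3 <= 3 ^ 3 by lia.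
have cl : closable t (3 - 2) 4 by apply: closable1; lia.
have sp : sparse e 3 setT by apply: (dense_sparse de cf dv _ n1 cl).
have spr : sparse (converse e) 3 setT.
  by apply: (dense_sparse (dense_converse de) (closed_free_converse cf) dv _ n1 cl).
have fe0 b : forever e t b = set0 /\ forever (converse e) t b = set0.
  have [le|/ltnW le] := leqP #|forever (converse e) t b| #|forever e t b|.
    have E := forever0 de t5 cf sp spr le; split=> //.
    by apply/eqP; rewrite -cards_eq0 -leqn0 -(cards0 V) -E.
  have E := forever0 (dense_converse de) t5 (closed_free_converse cf) spr sp le; split=> //.
  by apply/eqP; rewrite -cards_eq0 -leqn0 -(cards0 V) -E.
have snk b := sink_of_forever0 de (fe0 b).1.
have li : linked e 4.
  move=> y z; have [S [wS cS]] := ball_of_sink de (snk y).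
  have [S' [wS' cS']] := ball_of_sink (dense_converse de) (sink_of_forever0 (dense_converse de) (fe0 z).2).
  apply: balls_meet wS wS' _; case: (de) => _ _ _; move: cS cS'; clear; lia.
have [u [a [b [eua eab eub]]]] := transitive_triangle4 x de cf3.
have no3 p q r : e p q -> e q r -> e r p -> False.
  by move=> epq eqr erp; have /negP := cf3 p; apply; apply: walk3 epq eqr erp.
have no l : walk e l u u -> l <> t.
  by move=> wl E; have /negP := cf u; apply; rewrite -E.
(* the excluded lengths 2 and 3 leave only 4 *)
have w4 : walk e 4 u u.
  have [l [l1 l4 wl]] := li u u.
  have [E|[E|E]] := cases_2_4 l1 l4.
  - by subst l; have /negP := closed2 de u.
  - by subst l; have /negP := cf3 u.
  by subst l.
have [l [l1 l4 wl]] := li b u.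
have c1 := walkS eub wl; have c2 := walk_cat (walk2 eua eab) wl.
have w5 : walk e 5 u u.
  have [E|[E|E]] := cases_2_4 l1 l4.
  - by subst l; have /negP := cf3 u.
  - by subst l.
  by subst l.
have [t8|t8] := ltnP 8 t.
  have [|p [q E]] := combination_4_5 t8; first by apply: contraTneq t3 => ->.
  apply: (no t) => //; rewrite E.
  apply: (sum_closed_comb (L := fun l => walk e l u u)) => //.
    by move=> i j; apply: walk_cat.
  by rewrite -E; move: t8; clear; lia.
(* t is a multiple of 3 and not of 4, and 11 is no multiple of 3 *)
have Et : t = 6 by move: t3 t5 t8; clear; lia.
(* length 4 from b to u would give a closed walk of length 6 through a *)
subst t; have {l l1 l4 wl c1 c2} wl : walk e 3 b u.
  have [E|[E|E]] := cases_2_4 l1 l4.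
  - by subst l; have /negP := cf3 u.
  - by subst l.
  by subst l; have := no _ c2.
have /existsP[r /andP[ebr]] := wl; rewrite -/(walk e 2 r u) => /(@walk_split _ e 1 1)[s].
rewrite !walk1 => ers esu.
have [y [esy sink]] := snk s.
(* s is the last vertex before u on the walk from b, and y a sink of N+(s);
   a vertex in two of the four sets closes a walk of length 6 *)
apply: (dense_pack (s := [:: out (converse e) u; out e b; out e s; out e y]) de) => //=; last first.
  by rewrite !(dense_out _ de) !(dense_in _ de).
have bad_indices p l : walk e l p p -> l = 6 -> False.
  by move=> w E; have /negP := cf p; apply; rewrite -E.
have wbrs : walk e 3 u s by apply: walk3 eub ebr ers.
rewrite !andbT -!andbA; apply/and5P; split; last (apply/andP; split).
all: apply: disjoint_by => z; rewrite !in_out /converse.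
- by move=> ezu ebz; apply: (no3 u b z).
- move=> ezu esz.
  exact: (bad_indices u _ (walkS eua (walkS eab (walkS ebr (walk3 ers esz ezu)))) erefl).
- move=> ezu eyz.
  exact: (bad_indices u _ (walkS eub (walkS ebr (walkS ers (walk3 esy eyz ezu)))) erefl).
- move=> ebz esz; have [l [l1 l4 wzu]] := li z u.
  have [E|[E|E]] := cases_2_4 l1 l4; subst l.
  + exact: (bad_indices u _ (walk_cat (walk_rcons wbrs esz) wzu) erefl).
  + exact: (bad_indices u _ (walk_cat (walk3 eua eab ebz) wzu) erefl).
  exact: (bad_indices u _ (walk_cat (walk2 eub ebz) wzu) erefl).
- move=> ebz eyz; have [l [l1 l4 wzs]] := li z s.
  have [E|[E|E]] := cases_2_4 l1 l4; subst l.
  + exact: (bad_indices s _ (walkS esu (walk_cat (walk3 eua eab ebz) wzs)) erefl).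
  + exact: (bad_indices s _ (walk_cat (walk3 esu eub ebz) wzs) erefl).
  exact: (bad_indices s _ (walk_cat (walk2 esy eyz) wzs) erefl).
by move=> /sink/negP.
Qed.

End Four.

(** * Closed walks for k = 5, and for all k *)

Section Five.
Variable V : finType.
Implicit Types (e : rel V) (x y z v w : V) (A B S : {set V}).
Notation out e x := (nbr e setT x).

(** Let E be the set reached in two steps and O the set reached in one or
    three. If they are disjoint, counting the arcs from N+(w) to E and from E
    to O, at most one per pair, gives d(|N+(w)| + |E|) <= |E||O|, and so |E| +
    |O| >= 3d. *)
Lemma two_step_growth k d e w : dense_oriented k d e ->
  (forall u, walk e 2 w u -> (e w u \/ walk e 3 w u) -> False) ->
  exists S, within e 3 S w /\ 3 * d <= #|S|.
Proof.
move=> de no; pose W1 := out e w.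
pose W2 := [set u | walk e 2 w u]; pose O := [set u | e w u || walk e 3 w u].
exists (W2 :|: O); split.
  move=> u; rewrite !inE => /orP[wu|/orP[wu|wu]]; [exists 2|exists 1|exists 3]; split=> //.
  by rewrite walk1.
have dis : W2 :&: O = set0.
  apply/eqP; rewrite setI_eq0; apply: disjoint_by => u; rewrite !inE => wu /orP h.
  exact: no wu h.
rewrite cardsU dis cards0 subn0.
have c1 : d <= #|W1| := dense_out w de.
have W1O : W1 \subset O by apply/subsetP => u; rewrite in_out inE => ->.
have cO := subset_leq_card W1O.
have out2 u : u \in W1 -> out e u = nbr e W2 u.
  rewrite in_out => ewu; apply/setP => z; rewrite !in_nbr in_setT inE.
  by case euz : (e u z); rewrite ?andbF ?andbT // (walk2 ewu euz).
have outO u : u \in W2 -> out e u = nbr e O u.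
  rewrite inE => wu; apply/setP => z; rewrite !in_nbr in_setT inE.
  by case euz : (e u z); rewrite ?andbF ?andbT // (walk_rcons wu euz) orbT.
have s1 : \sum_(u in W1) d <= \sum_(u in W1) #|nbr e W2 u|.
  by apply: leq_sum => u uW; rewrite -out2 // (dense_out _ de).
have s2 : \sum_(u in W2) d <= \sum_(u in W2) #|nbr e O u|.
  by apply: leq_sum => u uW; rewrite -outO // (dense_out _ de).
have s3 : \sum_(u in W1) #|nbr e W2 u| + \sum_(u in W2) #|nbr e O u| <= #|O| * #|W2|.
  apply: leq_trans (_ : \sum_(u in O) #|nbr e W2 u| + \sum_(u in W2) #|nbr e O u| <= _).
    rewrite leq_add2r [X in _ <= X](big_setID W1) /= (setIidPr W1O) leq_addr //.
  rewrite !sum_card_nbr [X in _ + X <= _]exchange_big /= -big_split /= -sum_nat_const.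
  apply: leq_sum => u _; rewrite -big_split /= -sum1_card; apply: leq_sum => z _.
  case: (de) => as_ _ _ _; case euz : (e u z); case ezu : (e z u) => //.
  by have := as_ _ _ euz; rewrite ezu.
move: s1 s2 s3 c1 cO; rewrite !sum_nat_const; clear.
move: (\sum_(_ in W1) _) (\sum_(_ in W2) _) (#|W1|) (#|W2|) (#|O|) => a b p q r.
move=> h1 h2 h3 h4 h5; rewrite leqNgt; apply/negP => lt.
have [s Es] : exists s, r = d + s by exists (r - d); move: h4 h5; clear; lia.
subst r; have h6 : d * d <= q * s by nia.
have h7 : q + s < 2 * d by move: lt; clear; lia.
have h8 : 4 * (q * s) <= (q + s) * (q + s) by have [+ _] := nat_AGM2 q s; rewrite expnS expn1.
have h9 : (q + s).+1 * (q + s).+1 <= (2 * d) * (2 * d) by apply: leq_mul.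
move: h6 h8 h9; clear; nia.
Qed.

Lemma cases_2_5 l : 1 < l -> l <= 5 -> l = 2 \/ l = 3 \/ l = 4 \/ l = 5.
Proof. by lia. Qed.

(** Without closed walks of length 12 there are none of lengths 3, 4, 6, and
    no vertex has closed walks of both lengths 5 and 7. The aim is that every
    arc lies on a closed walk of length 5; then the out-neighbourhoods of the
    vertices of one such walk are five disjoint sets. *)
Lemma dense5_closed12 d e x0 : dense_oriented 5 d e -> closed_free e 12 -> False.
Proof.
move=> de0 cf0.
have cfd (f : rel V) l : closed_free f 12 -> l %| 12 -> closed_free f l by apply: closed_free_dvd.
have dv l : 2 < l < 5 -> l %| 12 by case: l => [|[|[|[|[|]]]]].
have n1 : 3 * 2 ^ 3 <= 3 ^ 3 by lia.
have n2 : 5 * 3 ^ (4 + 5) + 3 * 2 ^ 4 * 3 ^ 5 + 3 * 3 ^ 4 * 2 ^ 5 <= 2 * 3 * 3 ^ (4 + 5) by lia.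
have cl : closable 12 (3 - 2) 4 by apply: closable1.
have li9 (f : rel V) : dense_oriented 5 d f -> closed_free f 12 -> linked f 9.
  move=> de cf.
  exact: (linked_sparse (m := 3) (T := 3) (i := 4) (j := 5) de cf dv isT n1 cl isT isT n2).
clear n1 n2 cl.
have snk (f : rel V) x : dense_oriented 5 d f -> closed_free f 12 ->
    exists y, f x y /\ forall z, f x z -> ~~ f y z.
  by move=> de cf; apply: (sink_out x de cf (li9 f de cf)).
have b2 (f : rel V) x : dense_oriented 5 d f -> closed_free f 12 -> exists S, within f 2 S x /\ 2 * d <= #|S|.
  by move=> de cf; apply: ball_of_sink de (snk f x de cf).
have sum57 (f : rel V) v : closed_free f 12 -> walk f 5 v v -> walk f 7 v v -> False.
  by move=> cf w5 w7; have /negP := cf v; apply; apply: walk_cat w5 w7.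
(* Let y be a sink of N+(x) and S the union of N+(x) and N+(y). If S had no
   sink, a vertex w of N+(x) in a recurrent core of S would be reached from x
   in one step and with lengths in all windows of two integers. *)
have b3 (f : rel V) x : dense_oriented 5 d f -> closed_free f 12 -> exists S, within f 3 S x /\ 3 * d <= #|S|.
  move=> de cf; have [y [fxy sink]] := snk f x de cf.
  pose S := out f x :|: out f y.
  have wS : within f 2 S x.
    by apply: within_grow; [rewrite in_out|exact: within_nbr].
  have cS : 2 * d <= #|S|.
    rewrite cardsU (_ : _ :&: _ = set0) ?cards0 ?subn0; last first.
      by apply/eqP; rewrite setI_eq0; apply: disjoint_by => z; rewrite !in_out => /sink/negP.
    by rewrite mul2n -addnn leq_add ?(dense_out _ de).
  have S0 : S != set0.
    by apply/set0Pn; exists y; rewrite in_setU in_out fxy.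
  case: (boolP [exists y in S, [forall z in S, ~~ f y z]]).
    case/exists_inP => z zS /forall_inP snkz; exists (S :|: out f z); split.
      exact: within_grow.
    rewrite cardsU (_ : _ :&: _ = set0) ?cards0 ?subn0; last first.
      by apply/eqP; rewrite setI_eq0; apply: disjoint_by => u /snkz fzu; rewrite in_out; apply/negP.
    by have := dense_out z de; move: cS; clear; lia.
  rewrite negb_exists_in => /forall_inP nosink; exfalso.
  have [|Q [Q0 QS inQ]] := @recurrent_core _ f S S0.
    move=> z /nosink; rewrite negb_forall_in => /exists_inP[u uS].
    by rewrite negbK; exists u.
  have [w wQ fxw] : exists2 w, w \in Q & f x w.
    case: (boolP [exists w in Q, f x w]); first by case/exists_inP => w; exists w.
    rewrite negb_exists_in => /forall_inP avoid; exfalso.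
    have Qy : within f 1 Q y.
      move=> u uQ; exists 1; split=> //; rewrite walk1.
      have := subsetP QS _ uQ; rewrite in_setU !in_out.
      by rewrite (negPf (avoid u uQ)).
    have [w wQ] := set0Pn _ Q0.
    have [l [_ l9 wl]] := li9 f de cf w y.
    by have := no_return (closable1 (isT : 9 < 12)) cf (recurrent_core_flexible inQ Qy wQ) l9; rewrite wl.
  have fl : flexible f 2 x w := recurrent_core_flexible inQ (within_sub QS wS) wQ.
  have fl2 n : exists l, (l = n.+1 \/ l = n.+2) /\ walk f l x w.
    by have [l [l1 l2 wl]] := fl n; exists l; split=> //; move: l1 l2; clear; lia.
  case: (boolP [exists u, walk f 2 w u && (f w u || walk f 3 w u)]).
    case/existsP => u /andP[w2 h].
    (* two consecutive lengths from w to u fill the gaps of the lengths to w *)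
    have all3 n : walk f n.+3 x u.
      case/orP: h => [fwu|w3].
        have [l [[E|E] wl]] := fl2 n; subst l.
          by have := walk_cat wl w2; rewrite addn2.
        exact: walk_rcons wl fwu.
      case: n => [|n]; first exact: walkS fxw w2.
      have [l [[E|E] wl]] := fl2 n; subst l.
        by have := walk_cat wl w3; rewrite addn3.
      by have := walk_cat wl w2; rewrite addn2.
    have [l [_ l9 wl]] := li9 f de cf u x.
    have /negP := cf x; apply; have := walk_cat (all3 (9 - l)) wl.
    by have -> : (9 - l).+3 + l = 12 by move: l9; clear; lia.
  rewrite negb_exists => /forallP nou.
  have [|T [wT cT]] := @two_step_growth 5 d f w de.
    move=> u w2 h; have := nou u; rewrite w2 andTb => /negP; apply.
    by case: h => h; rewrite h ?orbT.
  (* otherwise w returns to x within 5 steps, hence in exactly 4, and a walk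
     of length 3 from x to w makes the lengths 5 and 7 *)
  have [P [wP cP]] := b2 (converse f) x (dense_converse de) (closed_free_converse cf).
  have [|l [l1 l5 wl]] := balls_meet wT wP.
    by case: (de) => _ _ _; move: cT cP; clear; lia.
  have c := walkS fxw wl.
  case: (cases_2_5 l1 l5) => [E|[E|[E|E]]]; subst l.
  - by have /negP := cfd f 3 cf isT x.
  - by have /negP := cfd f 4 cf isT x.
  - have [l [[E|E] wl']] := fl2 1; subst l.
      by have /negP := cfd f 6 cf isT x; apply; apply: walk_cat wl' wl.
    by apply: (sum57 f x cf c); apply: walk_cat wl' wl.
  by have /negP := cfd f 6 cf isT x.
have ret y z : e y z -> walk e 4 z y.
  move=> eyz; have [S [wS cS]] := b3 e z de0 cf0.
  have [P [wP cP]] := b2 (converse e) y (dense_converse de0) (closed_free_converse cf0).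
  have [|l [l1 l5 wl]] := balls_meet wS wP.
    by case: (de0) => _ _ _; move: cS cP; clear; lia.
  have c := walkS eyz wl.
  case: (cases_2_5 l1 l5) => [E|[E|[E|E]]]; subst l => //.
  - by have /negP := cfd e 3 cf0 isT y.
  - by have /negP := cfd e 4 cf0 isT y.
  by have /negP := cfd e 6 cf0 isT y.
have near1 u v : e u v -> [disjoint out e u & out e v].
  move=> euv; apply: disjoint_by => z; rewrite !in_out => euz evz.
  have /negP := cfd e 6 cf0 isT u; apply; exact: walk_cat (walk2 euv evz) (ret u z euz).
have near2 u v w : e u v -> e v w -> [disjoint out e u & out e w].
  move=> euv evw; apply: disjoint_by => z; rewrite !in_out => euz ewz.
  apply: (sum57 e u cf0); first exact: walkS euv (ret u v euv).
  exact: walk_cat (walk3 euv evw ewz) (ret u z euz).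
have [y1 e01] := dense_next x0 de0.
have /(@walk_split _ e 1 3)[y2] := ret _ _ e01; rewrite walk1 => e12.
move/(@walk_split _ e 1 2) => [y3]; rewrite walk1 => e23.
move/(@walk_split _ e 1 1) => [y4]; rewrite !walk1 => e34 e40.
apply: (dense_pack (s := [:: out e x0; out e y1; out e y2; out e y3; out e y4]) de0) => //=.
  rewrite (near1 _ _ e01) (near1 _ _ e12) (near1 _ _ e23) (near1 _ _ e34).
  rewrite (near2 _ _ _ e01 e12) (near2 _ _ _ e12 e23) (near2 _ _ _ e23 e34).
  rewrite (disjoint_sym _ (out e y3)) (near2 _ _ _ e34 e40).
  rewrite (disjoint_sym _ (out e y4)) (near1 _ _ e40).
  by rewrite (disjoint_sym _ (out e y4)) (near2 _ _ _ e40 e01).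
by rewrite !(dense_out _ de0).
Qed.

(** For k >= 5 it is enough to close a walk whose length divides t; for k = 3
    and k = 4 the smallest t, which are 4 and 6, are special. *)
Theorem closed_walk k d t e x : dense_oriented k d e -> 2 < k ->
  (forall i, 2 < i < k -> i %| t) -> ~~ (k %| t) -> 3 < t -> exists v, walk e t v v.
Proof.
move=> de k2 dv nk t3; case: (boolP [exists v, walk e t v v]).
  by case/existsP => v wv; exists v.
rewrite negb_exists => /forallP cf; exfalso; have {}cf : closed_free e t := cf.
have [k5|k6] := leqP k 5; last by apply: (dense_ge6_closed x de cf _ dv) => //; lia.
have kE : k = 3 \/ k = 4 \/ k = 5 by move: k2 k5; clear; lia.
case: kE => [E|[E|E]]; subst k.
- have [E|t4] := eqVneq t 4; first by subst t; apply: (dense3_closed4 x de cf).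
  by apply: (dense3_closed_ge5 x de cf); move: t3 t4; clear; lia.
- have d3 : 3 %| t by apply: dv.
  by apply: (dense4_closed x de cf) => //; move: d3 t3 nk; clear; lia.
have cf12 : closed_free e 12.
  by apply: closed_free_dvd cf _; apply: (@dvdn_coprime_mul 3 4); rewrite ?dv.
exact: (dense5_closed12 x de cf12).
Qed.

End Five.

(** * Homomorphisms from oriented cycles *)

Section Lines.
Variables (V : finType) (e : rel V).

Definition pattern_step b x y := if b then e x y else e y x.

Lemma walk_fun n x y : walk e n x y ->
  exists p : nat -> V, [/\ p 0 = x, p n = y & forall i, i < n -> e (p i) (p i.+1)].
Proof.
elim: n x => [|n IH] x; first by move=> /eqP->; exists (fun=> y).
case/existsP => z /andP[exz /IH[p [p0 pn ep]]].
exists (fun i => if i is i'.+1 then p i' else x); split=> // -[|i] /=; last exact: ep.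
by rewrite p0.
Qed.

(** Indexing by the integers lets heights be negative. *)
Definition biinfinite_walk (P : int -> V) := forall z : int, e (P z) (P (z + 1)%R).

(** Out- and in-neighbours are chosen to prolong the walk in both directions.
    *)
Lemma extend_line n x y : (forall x, exists y, e x y) -> (forall x, exists y, e y x) ->
  walk e n x y -> exists P, [/\ biinfinite_walk P, P 0%R = x & P n%:Z%R = y].
Proof.
move=> out inn /walk_fun[p [p0 pn ep]].
pose nx u := xchoose (out u); pose pv u := xchoose (inn u).
have nxP u : e u (nx u) by apply: xchooseP (out u).
have pvP u : e (pv u) u by apply: xchooseP (inn u).
exists (fun z => match z with
  | Posz i => if i <= n then p i else iter (i - n) nx (p n)
  | Negz i => iter i.+1 pv (p 0) end).
split; [|by rewrite /=|by rewrite leqnn].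
case=> [i|[|i]].
- have -> : (Posz i + 1)%R = Posz i.+1 by lia.
  case: (ltngtP i n) => [lt|gt|->]; first exact: ep.
  + by rewrite subSn ?(ltnW gt).
  by rewrite subSnn.
- have -> : (Negz 0 + 1)%R = Posz 0 by [].
  by rewrite leq0n /=.
have -> : (Negz i.+1 + 1)%R = Negz i by lia.
by rewrite [X in e X _]iterS.
Qed.

Lemma periodic_line n x : 0 < n -> walk e n x x ->
  exists P, biinfinite_walk P /\ forall z : int, P (z + n%:Z)%R = P z.
Proof.
move=> n0 /walk_fun[p [p0 pn ep]].
exists (fun z => p `|(z %% n%:Z)%Z|%N); split; last by move=> z; rewrite modzDr.
move=> z; have nz : n%:Z%R != 0%R by lia.
have m0 := modz_ge0 z nz; have mlt : ((z %% n)%Z < n%:Z)%R by rewrite ltz_pmod.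
have [i Ei] : exists i, (z %% n)%Z = Posz i by exists `|(z %% n)%Z|%N; lia.
have E1 : ((z + 1) %% n)%Z = ((Posz i + 1) %% n)%Z by rewrite -Ei modzDml.
rewrite E1 Ei; have [lt|ge] := ltnP i.+1 n.
  rewrite modz_small; last by lia.
  have -> : `|(Posz i + 1)%R|%N = i.+1 by lia.
  by apply: ep; lia.
have -> : (Posz i + 1)%R = n%:Z%R by lia.
rewrite modzz absz0 p0 -pn.
have Ein : i.+1 = n by lia.
by rewrite -[in X in e _ X]Ein; apply: ep; lia.
Qed.

End Lines.

Section Heights.
Variable C : oriented_cycle.

Lemma len_gt0 : 0 < len C. Proof. by have := len_ge3 C; lia. Qed.

Definition arrow j := @fwd C (Ordinal (ltn_pmod j len_gt0)).

Lemma arrowD j : arrow (j + len C) = arrow j.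
Proof. by congr (@fwd C _); apply: val_inj => /=; rewrite modnDr. Qed.

Lemma arrow_mod i j : i = j %[mod len C] -> arrow i = arrow j.
Proof. by move=> E; congr (@fwd C _); apply: val_inj => /=. Qed.

Lemma arrow_ord (i : 'I_(len C)) : arrow i = fwd i.
Proof. by congr (@fwd C _); apply: val_inj => /=; rewrite modn_small. Qed.

Definition arrow_sign (b : bool) : int := if b then 1%R else (-1)%R.

Definition height s j : int := (\sum_(0 <= i < j) arrow_sign (arrow (s + i)))%R.

Lemma height0 s : height s 0 = 0%R. Proof. by rewrite /height big_geq. Qed.

Lemma heightS s j : height s j.+1 = (height s j + arrow_sign (arrow (s + j)))%R.
Proof. by rewrite /height big_nat_recr. Qed.

Lemma height_len s : height s (len C) = height 0 (len C).
Proof.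
elim: s => [//|s <-]; apply/eqP; rewrite -subr_eq0; apply/eqP.
have E : (height s (len C).+1 = arrow_sign (arrow s) + height s.+1 (len C))%R.
  rewrite /height big_nat_recl // addn0; congr (_ + _)%R.
  by apply: eq_bigr => i _; rewrite addSnnS.
by move: E; rewrite heightS arrowD => E; lia.
Qed.

Lemma height_total : height 0 (len C) =
  (Posz #|[set i | @fwd C i]| - Posz #|[set i | ~~ @fwd C i]|)%R.
Proof.
rewrite /height big_mkord (bigID (@fwd C)) /=.
have h (P : pred 'I_(len C)) (c : int) : (forall i, P i -> arrow_sign (@fwd C i) = c) ->
    (\sum_(i < len C | P i) arrow_sign (arrow (0 + i)) = c * Posz #|[set i | P i]|)%R.
  move=> Pc; rewrite (eq_bigr (fun=> c)); last by move=> i Pi; rewrite add0n arrow_ord Pc.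
  by rewrite sumr_const -mulr_natr cardsE natz.
rewrite (h _ 1%R); last by move=> i ->.
by rewrite (h _ (-1)%R) ?mul1r ?mulN1r // => i /negPf->.
Qed.

Lemma height_type : `|height 0 (len C)|%N = cycle_type C.
Proof. by rewrite height_total. Qed.

Definition hom_cycle (V : finType) (e : rel V) :=
  exists f : 'I_(len C) -> V, forall i j, cycle_arc i j -> e (f i) (f j).

(** Reading C from position s allows the exceptional edge of C to come last.
    *)
Lemma hom_of_fun (V : finType) (e : rel V) s (p : nat -> V) : s <= len C ->
  p (len C) = p 0 ->
  (forall j, j < len C -> pattern_step e (arrow (s + j)) (p j) (p j.+1)) -> hom_cycle e.
Proof.
move=> sl pl ps; have l3 := len_ge3 C; have l0 := len_gt0.
pose pos (i : nat) := (i + (len C - s)) %% len C.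
suff st (i : 'I_(len C)) : pattern_step e (fwd i) (p (pos i)) (p (pos (ordS i))).
  exists (fun i => p (pos i)) => i j /orP[] /andP[/eqP-> fi].
    by have := st i; rewrite /pattern_step fi.
  by have := st j; rewrite /pattern_step (negPf fi).
have jl : pos i < len C by rewrite ltn_mod.
have := ps _ jl; have -> : arrow (s + pos i) = fwd i.
  rewrite -(arrow_ord i); apply: arrow_mod; rewrite modnDmr addnCA subnKC //.
  by rewrite modnDr.
suff -> : p (pos i).+1 = p (pos (ordS i)) by [].
have -> : pos (ordS i) = (pos i).+1 %% len C.
  by rewrite /pos /= modnDml -addn1 -(addn1 (_ %% _)) modnDml addnAC.
have [lt|ge] := ltnP (pos i).+1 (len C); first by rewrite modn_small.
have -> : (pos i).+1 = len C by lia.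
by rewrite modnn.
Qed.

Lemma pattern_step_line (V : finType) (e : rel V) P s (z : int) j : biinfinite_walk e P ->
  pattern_step e (arrow (s + j)) (P (z + height s j)%R) (P (z + height s j.+1)%R).
Proof.
move=> li; rewrite heightS /pattern_step /arrow_sign; case: (arrow _); first by rewrite addrA.
have := li (z + (height s j + -1))%R.
by have -> : (z + (height s j + -1) + 1 = z + height s j)%R by lia.
Qed.

Variables (V : finType) (e : rel V).

(** Heights along C change by one at each edge, in the direction of the edge.
    *)
Lemma hom_of_line P : biinfinite_walk e P -> P (height 0 (len C)) = P 0%R -> hom_cycle e.
Proof.
move=> li pl; apply: (@hom_of_fun _ e 0 (fun j => P (height 0 j))) => //.
  by rewrite height0.
by move=> j _; have := pattern_step_line 0 0 j li; rewrite !add0r.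
Qed.

Lemma hom_closed_walk x : 0 < cycle_type C -> walk e (cycle_type C) x x -> hom_cycle e.
Proof.
move=> t0 /(periodic_line t0)[P [li per]]; apply: (hom_of_line li).
have := height_type; set h := height _ _ => ht.
have [->|->] : h = Posz (cycle_type C) \/ h = (- Posz (cycle_type C))%R by lia.
  by rewrite -(per 0%R) add0r.
by rewrite -(per (- _)%R) addNr.
Qed.

Hypotheses (out : forall x, exists y, e x y) (inn : forall x, exists y, e y x).

Lemma hom_balanced (x : V) : cycle_type C = 0 -> hom_cycle e.
Proof.
move=> t0; have [P [li _ _]] := extend_line out inn (walk0 e x).
apply: (hom_of_line li); congr P; have := height_type; rewrite t0; lia.
Qed.

(** Cut C at an edge against the overall direction. The remaining path has
    total height t + 1 and is mapped along the long walk, extended in both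
    directions; the cut edge is mapped to the arc from x to y. *)
Lemma hom_shortcut x y : e x y -> walk e (cycle_type C).+1 x y ->
  (exists i, @fwd C i) -> (exists i, ~~ @fwd C i) -> hom_cycle e.
Proof.
move=> exy wxy [i fi] [j fj]; have [P [li P0 Pt]] := extend_line out inn wxy.
have l3 := len_ge3 C.
have last s : height s (len C).-1 = (height 0 (len C) - arrow_sign (arrow (s + (len C).-1)))%R.
  by rewrite -(height_len s) -[in X in (X - _)%R](ltn_predK l3) heightS addrK.
have dlast (k : 'I_(len C)) : arrow (k.+1 + (len C).-1) = fwd k.
  by rewrite addSnnS (ltn_predK l3) arrowD arrow_ord.
have := height_type; set h := height _ _ in last * => ht.
(* k is the position of the cut edge, and z the height of its end *)
have main (k : 'I_(len C)) (z : int) :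
    pattern_step e (fwd k) (P (z + (h - arrow_sign (fwd k)))%R) (P z) -> hom_cycle e.
  move=> stk; pose p j := if j == len C then P z else P (z + height k.+1 j)%R.
  apply: (@hom_of_fun _ e k.+1 p (ltn_ord k)).
    by rewrite /p eqxx height0 addr0; case: eqP.
  move=> m ml; rewrite /p (ltn_eqF ml).
  have [E|_] := eqVneq m.+1 (len C); last exact: pattern_step_line.
  have Em : m = (len C).-1 by rewrite -E.
  by rewrite Em last dlast.
have [Eh|Eh] : h = Posz (cycle_type C) \/ h = (- Posz (cycle_type C))%R by lia.
  apply: (main j 0%R); rewrite (negPf fj) /pattern_step /arrow_sign P0.
  by have -> : (0 + (h - -1) = Posz (cycle_type C).+1)%R by [lia]; rewrite Pt.
apply: (main i (Posz (cycle_type C).+1)); rewrite fi /pattern_step /arrow_sign Pt.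
by have -> : (Posz (cycle_type C).+1 + (h - 1) = 0)%R by [lia]; rewrite P0.
Qed.

End Heights.

(** * Boxes in dense sets of tuples *)

Section Update.
Variables (V : finType) (m : nat).
Notation Omega := {ffun 'I_m -> V}.

Definition update (s : Omega) k v : Omega := [ffun i => if i == k then v else s i].

Lemma update_eq s k v : update s k v k = v. Proof. by rewrite ffunE eqxx. Qed.

Lemma update_neq s k v i : i != k -> update s k v i = s i.
Proof. by move=> ik; rewrite ffunE (negPf ik). Qed.

(** The map (s, v) |-> (s with value v at k, s k) is an involution. *)
Lemma update_sum (M : nmodType) (F : Omega -> M) k :
  (\sum_s \sum_v F (update s k v) = (\sum_s F s) *+ #|V|)%R.
Proof.
rewrite pair_big /=.
pose h (p : Omega * V) := (update p.1 k p.2, p.1 k).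
have hK : involutive h.
  case=> s v; rewrite /h /= update_eq; congr (_, _); apply/ffunP => i.
  by rewrite !ffunE; case: eqP => // ->.
rewrite (reindex_inj (inv_inj hK)) /=.
rewrite (eq_bigr (fun p => F p.1)); last first.
  case=> s v _; congr F; apply/ffunP => i.
  by rewrite /h !ffunE; case: eqP => // ->.
rewrite -(pair_big predT predT (fun s _ => F s)) /= -sumrMnl.
by apply: eq_bigr => s _; rewrite sumr_const.
Qed.

End Update.

Section Box.
Variables (V : finType) (m l : nat).
Notation Omega := {ffun 'I_m -> V}.

(** Few functions from k points to n points fail to be injective. *)
Lemma ffact_expn n k : n * n ^ k <= n * n ^_ k + k * k * n ^ k.
Proof.
elim: k => [|k IH]; first by rewrite ffactn0 expn0 addn0.
have [nk|kn] := ltnP n k.+1.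
  apply: leq_trans (leq_addl _ _); rewrite leq_mul2r; apply/orP; right.
  by apply: leq_trans (ltnW nk) _; rewrite leq_pmulr.
rewrite ffactnSr !expnS.
have le : n ^_ k <= n ^ k.
  elim: (k) => [|j IHj]; first by rewrite ffactn0.
  by rewrite ffactnSr expnSr leq_mul // leq_subr.
move: IH le; set a := n ^ k; set b := n ^_ k => IH le.
have : n * (n * a) <= n * (n * b + k * k * a) by rewrite leq_mul2l IH orbT.
have E : n = (n - k) + k by lia.
set c := n - k in E *; nia.
Qed.

(** By averaging, many tuples s have at least n/2K values v at j that keep s
    in A. Raising this number to the power l counts the l-tuples of such
    values, so some injective l-tuple works for a positive proportion of the
    s. *)
Lemma box_step K (A : {set Omega}) (j : 'I_m) :
  0 < K -> 2 * (2 * K) ^ l.+1 * (l * l) < #|V| -> #|{: Omega}| <= K * #|A| ->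
  exists x : 'I_l -> V, injective x /\
    #|{: Omega}| <= 2 * (2 * K) ^ l.+1 * #|[set s : Omega | [forall i, update s j (x i) \in A]]|.
Proof.
move=> K0 big AK; set N := #|{: Omega}| in AK *; set n := #|V| in big *.
have n0 : 0 < n by lia.
pose d (s : Omega) := #|[set v | update s j v \in A]|.
have sumd : \sum_s d s = n * #|A|.
  have := update_sum (fun s : Omega => nat_of_bool (s \in A)) j.
  rewrite (_ : (_ *+ _)%R = n * #|A|); last first.
    have mn (a b : nat) : (a *+ b)%R = b * a.
      by elim: b => [|b IH]; rewrite ?mulr0n // mulrS IH mulSn.
    rewrite mn; congr (_ * _).
    by rewrite -sum1_card [RHS]big_mkcond; apply: eq_bigr => s _; case: (s \in A).
  move=> <-; apply: eq_bigr => s _; rewrite /d -sum1_card big_mkcond /=.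
  by apply: eq_bigr => v _; rewrite inE; case: (_ \in A).
(* tuples with at least n/2K admissible values *)
pose B := [set s | n <= 2 * K * d s].
have cB : N <= 2 * K * #|B|.
  have : 2 * K * (n * #|A|) <= 2 * K * (n * #|B|) + N * n.
    rewrite -sumd (bigID (mem B)) /= mulnDr leq_add //.
      rewrite leq_mul2l; apply/orP; right; rewrite mulnC -sum_nat_const.
      by apply: leq_sum => s _; apply: max_card.
    rewrite big_distrr /=; apply: leq_trans (_ : \sum_(s | s \notin B) n <= _).
      by apply: leq_sum => s; rewrite inE -ltnNge => /ltnW.
    by rewrite sum_nat_const leq_mul2r max_card orbT.
  have : 2 * n * N <= 2 * n * (K * #|A|) by rewrite leq_mul2l AK orbT.
  move=> h1 h2; rewrite -(leq_pmul2l n0); move: h1 h2; clear; lia.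
pose cnt (x : {ffun 'I_l -> V}) := #|[set s : Omega | [forall i, update s j (x i) \in A]]|.
have dpow s : d s ^ l = #|[set x : {ffun 'I_l -> V} | [forall i, update s j (x i) \in A]]|.
  rewrite /d -[l in LHS]card_ord -card_ffun_on; apply: eq_card => x.
  rewrite !inE; apply/ffun_onP/forallP => h i; first by have := h i; rewrite inE.
  by rewrite inE.
have sumx : \sum_x cnt x = \sum_s d s ^ l.
  under [RHS]eq_bigr => s _ do rewrite dpow -sum1_card big_mkcond /=.
  rewrite exchange_big /=; apply: eq_bigr => x _.
  by rewrite /cnt -sum1_card big_mkcond /=; apply: eq_bigr => s _; rewrite !inE.
(* lower bound from B against an upper bound where no injective x is good *)
have low : N * n ^ l <= (2 * K) ^ l.+1 * \sum_x cnt x.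
  rewrite sumx expnS; apply: leq_trans (_ : (2 * K * #|B|) * n ^ l <= _).
    by rewrite leq_mul2r cB orbT.
  rewrite -!mulnA !leq_pmul2l // big_distrr /= (bigID (mem B)) /=.
  apply: leq_trans (leq_addr _ _); rewrite -sum_nat_const.
  by apply: leq_sum => s; rewrite inE -expnMn; case: (l) => [//|l'] le; rewrite leq_exp2r.
set c := (2 * K) ^ l.+1 in big low *.
case: (boolP [exists x : {ffun 'I_l -> V}, injectiveb x && (N <= 2 * c * cnt x)]).
  case/existsP => x /andP[/injectiveP xi le]; exists x; split=> //.
rewrite negb_exists => /forallP no; exfalso.
have N0 : 0 < N.
  apply/card_gt0P; have /card_gt0P[v _] : 0 < #|V| by [].
  by exists [ffun => v].
pose J := #|[set x : {ffun 'I_l -> V} | injectiveb x]|.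
have cJ : n * n ^ l <= n * J + (l * l) * n ^ l.
  by have := ffact_expn n l; rewrite /J card_inj_ffuns card_ord.
have tot : #|{: {ffun 'I_l -> V}}| = n ^ l by rewrite card_ffun card_ord.
have up : 2 * c * \sum_x cnt x <= J * N + 2 * c * ((n ^ l - J) * N).
  rewrite (bigID (fun x : {ffun 'I_l -> V} => injectiveb x)) /= mulnDr leq_add //.
    rewrite big_distrr /= /J -sum_nat_const.
    rewrite [X in _ <= X](eq_bigl (fun x : {ffun 'I_l -> V} => injectiveb x)); last by move=> x; rewrite inE.
    by apply: leq_sum => x xi; have := no x; rewrite xi /= -ltnNge => /ltnW.
  rewrite leq_mul2l; apply/orP; right.
  have -> : n ^ l - J = #|[set x : {ffun 'I_l -> V} | ~~ injectiveb x]|.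
    rewrite -tot /J -[X in X - _](cardsC [set x : {ffun 'I_l -> V} | injectiveb x]) addKn.
    by apply: eq_card => x; rewrite !inE.
  rewrite -sum_nat_const [X in _ <= X](eq_bigl (fun x : {ffun 'I_l -> V} => ~~ injectiveb x)); last by move=> x; rewrite inE.
  by apply: leq_sum => x _; apply: max_card.
have Jn : J <= n ^ l by rewrite -tot max_card.
have nl : 0 < n ^ l by rewrite expn_gt0 n0.
have h1 : 2 * (N * n ^ l) <= J * N + 2 * c * ((n ^ l - J) * N).
  by apply: leq_trans up; rewrite -mulnA leq_mul2l.
have h2 : 2 * n ^ l <= J + 2 * c * (n ^ l - J).
  rewrite -(leq_pmul2l N0); move: h1; clear; lia.
have h3 : n ^ l <= 2 * c * (n ^ l - J) by move: h2 Jn; clear; lia.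
have h4 : n * n ^ l <= 2 * c * ((l * l) * n ^ l).
  apply: leq_trans (_ : n * (2 * c * (n ^ l - J)) <= _); first by rewrite leq_mul2l h3 orbT.
  rewrite mulnCA leq_mul2l; apply/orP; right; rewrite mulnBr leq_subLR //.
move: h4; rewrite mulnA leq_pmul2r // leqNgt; by rewrite big.
Qed.

End Box.

(** The coordinates are widened to l values one at a time. *)
Lemma box m l (r : seq 'I_m) K : 0 < K -> exists n0, forall (V : finType)
    (A : {set {ffun 'I_m -> V}}), n0 < #|V| -> #|{: {ffun 'I_m -> V}}| <= K * #|A| ->
  exists X : 'I_m -> 'I_l -> V, (forall j, j \in r -> injective (X j)) /\
   exists s : {ffun 'I_m -> V}, forall g : 'I_m -> 'I_l,
     [ffun i => if i \in r then X i (g i) else s i] \in A.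
Proof.
elim: r K => [|j r IH] K K0.
  exists 0 => V A /card_gt0P[v _] AK.
  have [s sA] : exists s, s \in A.
    apply/card_gt0P; have : 0 < #|{: {ffun 'I_m -> V}}|.
      by apply/card_gt0P; exists [ffun => v].
    by case: #|A| AK => //; rewrite muln0 leqNgt => /negPf->.
  exists (fun _ _ => v); split=> //; exists s => g.
  by rewrite (_ : [ffun i => _] = s) //; apply/ffunP => i; rewrite ffunE.
have K'0 : 0 < 2 * (2 * K) ^ l.+1 by rewrite muln_gt0 expn_gt0 muln_gt0 K0.
have [n0 H] := IH _ K'0; exists (maxn n0 (2 * (2 * K) ^ l.+1 * (l * l))) => V A.
rewrite gtn_max => /andP[big1 big2] AK.
have [x [xi AK']] := box_step j K0 big2 AK.
have [X [Xi [s sX]]] := H V _ big1 AK'.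
exists (fun i => if i == j then x else X i); split.
  by move=> i; rewrite inE; case: eqP => [_ _|_ /Xi].
exists s => g; have := sX g; rewrite inE => /forallP/(_ (g j)).
congr (_ \in A); apply/ffunP => i; rewrite !ffunE inE.
by case: eqP => [->|].
Qed.

(** Greedy: fewer than |W| values are taken before each choice. *)
Lemma distinct_choice (W V : finType) (B : W -> {set V}) :
  (forall w, #|W| <= #|B w|) -> exists f : W -> V, injective f /\ forall w, f w \in B w.
Proof.
move=> big.
have [w0 _|W0] := pickP (@predT W); last first.
  have none (w : W) : False by have := W0 w.
  by exists (fun w => match none w with end); split=> w; case: (none w).
have [v0 _] : exists v, v \in B w0.
  by apply/card_gt0P; apply: leq_trans (big w0); apply/card_gt0P; exists w0.
suff H (r : seq W) : uniq r -> exists f : W -> V,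
    {in r &, injective f} /\ {in r, forall w, f w \in B w}.
  have [f [fi fB]] := H (enum W) (enum_uniq W).
  by exists f; split=> [w w' | w]; [apply: fi|apply: fB]; rewrite mem_enum.
elim: r => [_|w r IH /= /andP[wr ur]]; first by exists (fun=> v0); split.
have [f [fi fB]] := IH ur.
have [v vB] : exists v, v \in B w :\: [set f u | u in r].
  apply/set0Pn; rewrite -card_gt0 cardsD subn_gt0.
  apply: leq_ltn_trans (subset_leq_card (subsetIr _ _)) _.
  apply: leq_ltn_trans (leq_imset_card _ _) _; apply: leq_trans (big w).
  have -> : #|r| = size r by apply/card_uniqP.
  have := max_card (mem (w :: r)); rewrite (card_uniqP _) //= wr ur //.
move: vB; rewrite in_setD => /andP[vf vB].
have ne u : u \in r -> f u != v.
  by move=> ur'; apply: contraNneq vf => <-; apply: imset_f.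
exists (fun u => if u == w then v else f u); split.
  move=> u u'; rewrite !inE; case: (eqVneq u w) => [->|_]; case: (eqVneq u' w) => [->|_] //=.
  - by move=> _ u'r E; have := ne u' u'r; rewrite E eqxx.
  - by move=> u'r _ E; have := ne u u'r; rewrite E eqxx.
  exact: fi.
move=> u; rewrite inE; case: (eqVneq u w) => [->|_] //=; exact: fB.
Qed.

Local Open Scope ring_scope.

(** * The variance of sampled degrees *)

Section Moment.
Variables (R : realFieldType) (V : finType) (e : rel V) (m : nat).
Notation Omega := {ffun 'I_m -> V}.
Hypothesis V0 : (0 < #|V|)%N.

(** Centred so that the sum over v vanishes. *)
Definition deviation u v : R := (e u v)%:R - #|nbr e setT u|%:R / #|V|%:R.

Lemma card_sum (T : finType) (P : pred T) : \sum_(v : T) (P v)%:R = #|[set v | P v]|%:R :> R.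
Proof.
rewrite -sum1_card natr_sum [RHS]big_mkcond /=.
by apply: eq_bigr => v _; rewrite inE; case: (P v).
Qed.

Lemma deviation_sum u : \sum_v deviation u v = 0.
Proof.
rewrite sumrB sumr_const card_sum (_ : [set v | e u v] = nbr e setT u); last first.
  by apply/setP => v; rewrite in_nbr in_setT inE.
by rewrite -[X in _ - X]mulr_natr mulfVK ?subrr // pnatr_eq0 -lt0n.
Qed.

Lemma deviation_sqr u v : deviation u v ^+ 2 <= 1.
Proof.
have D0 : 0 <= #|nbr e setT u|%:R / #|V|%:R :> R by rewrite divr_ge0.
have D1 : #|nbr e setT u|%:R / #|V|%:R <= 1 :> R.
  by rewrite ler_pdivrMr ?ltr0n // mul1r ler_nat max_card.
rewrite /deviation; move: D0 D1; set q := _ / _ => q0 q1.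
by case: (e u v); rewrite /= ?mulr1n ?mulr0n; nra.
Qed.

(** Summing first over the coordinate k, which occurs only in the last factor.
    *)
Lemma deviation_uncorrelated (i j k : 'I_m) : k != j -> k != i ->
  \sum_(s : Omega) deviation (s i) (s j) * deviation (s i) (s k) = 0.
Proof.
move=> kj ki; have := update_sum (fun s : Omega => deviation (s i) (s j) * deviation (s i) (s k)) k.
rewrite big1 => [/esym/eqP|s _].
  by rewrite mulrn_eq0 gtn_eqF //= => /eqP.
under eq_bigr => v _ do rewrite update_eq !update_neq 1?eq_sym //.
by rewrite -mulr_sumr deviation_sum mulr0.
Qed.

Lemma second_moment (i : 'I_m) :
  \sum_(s : Omega) (\sum_j deviation (s i) (s j)) ^+ 2 <= m%:R * #|{: Omega}|%:R.
Proof.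
have -> : \sum_(s : Omega) (\sum_j deviation (s i) (s j)) ^+ 2 =
    \sum_j \sum_(s : Omega) deviation (s i) (s j) ^+ 2.
  under eq_bigr => s _ do rewrite expr2 big_distrlr /=.
  rewrite exchange_big /=; apply: eq_bigr => j _.
  rewrite exchange_big /= (bigD1 j) //= [X in _ + X]big1 ?addr0 // => k kj.
  have [ki|ki] := eqVneq k i; last exact: deviation_uncorrelated.
  under eq_bigr => s _ do rewrite mulrC.
  by apply: deviation_uncorrelated; rewrite eq_sym -?ki.
rewrite -[m in m%:R]card_ord -sum1_card natr_sum mulr_suml; apply: ler_sum => j _.
rewrite mul1r -sum1_card natr_sum; apply: ler_sum => s _; exact: deviation_sqr.
Qed.

Definition sample_deg (s : Omega) i := #|[set j | e (s i) (s j)]|.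

(** Chebyshev inequality, from the variance bound. *)
Lemma few_bad (b h : R) (i : 'I_m) : 0 < h ->
  (forall v, (b + h) * #|V|%:R <= #|nbr e setT v|%:R) ->
  #|[set s | (sample_deg s i)%:R < b * m%:R]|%:R * (h ^+ 2 * m%:R) <= #|{: Omega}|%:R.
Proof.
move=> h0 deg; have m0 : (0 < m)%N := leq_ltn_trans (leq0n i) (ltn_ord i).
have mR : 0 < m%:R :> R by rewrite ltr0n.
have nR : 0 < #|V|%:R :> R by rewrite ltr0n.
set Bd := [set s | _].
suff : #|Bd|%:R * (h * m%:R) ^+ 2 <= m%:R * #|{: Omega}|%:R.
  by rewrite exprMn [m%:R ^+ 2]expr2 !mulrA -[_ * m%:R * m%:R]mulrC ler_pM2l // !mulrA.
apply: le_trans (second_moment i); rewrite (bigID (mem Bd)) /=.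
apply: le_trans (_ : \sum_(s in Bd) (\sum_j deviation (s i) (s j)) ^+ 2 <= _); last first.
  by rewrite lerDl sumr_ge0 // => s _; rewrite sqr_ge0.
rewrite -sum1_card natr_sum mulr_suml; apply: ler_sum => s; rewrite inE => bad_indices.
rewrite mul1r.
have -> : \sum_j deviation (s i) (s j) =
    (sample_deg s i)%:R - m%:R * (#|nbr e setT (s i)|%:R / #|V|%:R).
  by rewrite sumrB sumr_const card_sum card_ord -[X in _ - X]mulr_natl.
set q := _ / _.
have le : b + h <= q by rewrite ler_pdivlMr.
have : (b + h) * m%:R <= q * m%:R by rewrite ler_pM2r.
move: bad_indices; set x := (sample_deg s i)%:R; set y := q * m%:R; rewrite (mulrC m%:R q) -/y.
rewrite mulrDl => bad_indices le'.
have hm : 0 <= h * m%:R by rewrite mulr_ge0 // ltW.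
have : h * m%:R <= y - x by lra.
move: hm; set z := h * m%:R => hm le2.
rewrite -(sqrrN (x - y)) opprB; by rewrite ler_sqr ?nnegrE // (le_trans hm).
Qed.

End Moment.

(** * From homomorphisms of samples to subgraphs *)

Section Good.
Variables (R : realFieldType) (V : finType) (e : rel V) (m : nat) (b h : R).
Notation Omega := {ffun 'I_m -> V}.

Definition bad_indices (s : Omega) := [set i | ((sample_deg e s i)%:R < b * m%:R)
  || ((sample_deg (converse e) s i)%:R < b * m%:R)].

Hypothesis V0 : (0 < #|V|)%N.
Hypothesis m0 : (0 < m)%N.
Hypothesis h0 : 0 < h.
Hypothesis deg_out : forall v, (b + h) * #|V|%:R <= #|nbr e setT v|%:R.
Hypothesis deg_in : forall v, (b + h) * #|V|%:R <= #|nbr (converse e) setT v|%:R.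

Lemma sum_bad_indices : h ^+ 2 * \sum_(s : Omega) #|bad_indices s|%:R <= 2 * #|{: Omega}|%:R.
Proof.
have mR : 0 < m%:R :> R by rewrite ltr0n.
rewrite -(ler_pM2l mR) mulrA [m%:R * h ^+ 2]mulrC.
pose B f (i : 'I_m) := [set s : Omega | (sample_deg f s i)%:R < b * m%:R].
have le : \sum_(s : Omega) #|bad_indices s|%:R <= \sum_i (#|B e i|%:R + #|B (converse e) i|%:R) :> R.
  have E f : \sum_i #|B f i|%:R = \sum_(s : Omega) #|[set i | (sample_deg f s i)%:R < b * m%:R]|%:R :> R.
    under eq_bigr => i _ do rewrite -card_sum.
    rewrite exchange_big /=; apply: eq_bigr => s _; by rewrite card_sum.
  rewrite big_split /= !E -big_split /=; apply: ler_sum => s _.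
  rewrite -natrD ler_nat; apply: leq_trans (leq_card_setU _ _).
  by apply: subset_leq_card; apply/subsetP => i; rewrite !inE.
apply: le_trans (_ : h ^+ 2 * m%:R * \sum_i (#|B e i|%:R + #|B (converse e) i|%:R) <= _).
  by rewrite ler_pM2l ?mulr_gt0 ?exprn_gt0.
have -> : m%:R * (2 * #|{: Omega}|%:R) = \sum_(i < m) (2 * #|{: Omega}|%:R) :> R.
  by rewrite sumr_const card_ord -[RHS]mulr_natl.
rewrite mulrC mulr_suml.
apply: ler_sum => i _; rewrite mulrDl mulr2n mulrDl !mul1r lerD //.
  exact: few_bad.
exact: few_bad.
Qed.

(** Markov inequality for the number of bad indices. *)
Lemma many_good : 4 <= h ^+ 3 * m%:R ->
  (#|{: Omega}| <= 2 * #|[set s | (#|bad_indices s|%:R < h * m%:R)%R]|)%N.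
Proof.
move=> big; have mR : 0 < m%:R :> R by rewrite ltr0n.
set G := [set s | _]; have := sum_bad_indices.
have : #|~: G|%:R * (h * m%:R) <= \sum_(s : Omega) #|bad_indices s|%:R.
  rewrite -sum1_card natr_sum mulr_suml [X in _ <= X](bigID (mem G)) /=.
  apply: le_trans (_ : \sum_(s | s \notin G) #|bad_indices s|%:R <= _); last first.
    by rewrite lerDr sumr_ge0.
  rewrite [X in _ <= X](eq_bigl (mem (~: G))); last by move=> s; rewrite !inE.
  by apply: ler_sum => s; rewrite !inE mul1r -leNgt.
have := cardsC G; rewrite -(ler_nat R) natrM => <-; rewrite natrD.
set x := #|G|%:R; set y := #|~: G|%:R; set S := \sum_s _ => le1 le2.
have y0 : 0 <= y by rewrite /y ler0n.
have : h ^+ 2 * (y * (h * m%:R)) <= 2 * (x + y).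
  by apply: le_trans le2; rewrite ler_pM2l ?exprn_gt0.
have -> : h ^+ 2 * (y * (h * m%:R)) = y * (h ^+ 3 * m%:R) by ring.
have : y * 4 <= y * (h ^+ 3 * m%:R) by rewrite ler_wpM2l.
lra.
Qed.

Lemma sub_card (s : Omega) (f : rel V) (x : {i | i \notin bad_indices s}) :
  #|nbr (fun i j => f (s (val i)) (s (val j))) setT x| =
  #|[set j | (j \notin bad_indices s) && f (s (val x)) (s j)]|.
Proof.
rewrite -(card_imset _ val_inj); apply: eq_card => j.
apply/imsetP/idP => [[z]|].
  by rewrite in_nbr => /andP[_ fz] ->; rewrite inE fz (valP z).
rewrite inE; case/andP => jb fj; by exists (Sub j jb) => //; rewrite in_nbr in_setT.
Qed.

(** Deleting fewer than h m bad indices lowers the degrees from b m to no less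
    than (b - h)m. *)
Lemma good_deg (s : Omega) (f : rel V) (x : {i | i \notin bad_indices s}) : 0 <= b - h ->
  #|bad_indices s|%:R < h * m%:R -> b * m%:R <= (sample_deg f s (val x))%:R ->
  (b - h) * #|{: {i | i \notin bad_indices s}}|%:R <
    #|nbr (fun i j => f (s (val i)) (s (val j))) setT x|%:R.
Proof.
move=> bh few le; apply: le_lt_trans (_ : (b - h) * m%:R < _).
  by rewrite ler_wpM2l // ler_nat -[X in (_ <= X)%N]card_ord card_sig max_card.
rewrite sub_card; set T := [set j | _].
have : (sample_deg f s (val x) <= #|T| + #|bad_indices s|)%N.
  apply: leq_trans (leq_card_setU _ _); apply: subset_leq_card.
  by apply/subsetP => j; rewrite in_setU !inE => ->; rewrite andbT orNb.
rewrite -(ler_nat R) natrD mulrBl; lra.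
Qed.

End Good.

Section Sampling.
Variables (R : realType) (W : finType) (a : rel W) (alpha : R).

(** The average over all samples shows that one map phi from W to the indices
    works for a positive proportion of them. A box in this set provides as
    many values as W has elements at each index; distinct values for the
    vertices of W then form an injective copy, since adjacent vertices have
    different indices. *)
Theorem sampling (eps : R) : 0 <= alpha -> 0 < eps ->
  (forall (V : finType) (e : rel V), (forall x y, e x y -> ~~ e y x) -> (0 < #|V|)%N ->
     (forall x, alpha * #|V|%:R < #|nbr e setT x|%:R) ->
     (forall x, alpha * #|V|%:R < #|nbr (converse e) setT x|%:R) ->
     exists f : W -> V, forall x y, a x y -> e (f x) (f y)) ->
  exists n0 : nat, forall (V : finType) (e : rel V),
    (forall x y, e x y -> ~~ e y x) -> (n0 < #|V|)%N ->
     (forall x, (alpha + eps) * #|V|%:R <= #|nbr e setT x|%:R) ->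
     (forall x, (alpha + eps) * #|V|%:R <= #|nbr (converse e) setT x|%:R) ->
     exists f : W -> V, injective f /\ forall x y, a x y -> e (f x) (f y).
Proof.
move=> al0 eps0 hom; pose h := eps / 2; pose b := alpha + h.
have h0 : 0 < h by rewrite divr_gt0.
have Eb : b + h = alpha + eps by rewrite /b /h; lra.
have Eh : b - h = alpha by rewrite /b addrK.
have bh : 0 <= b - h by rewrite Eh.
(* the size needed in many_good *)
pose m := (Num.bound (4 / h ^+ 3)).+1.
have big : 4 <= h ^+ 3 * m%:R.
  rewrite mulrC -ler_pdivrMr ?exprn_gt0 //.
  have : 4 / h ^+ 3 < (Num.bound (4 / h ^+ 3))%:R.
    by apply: archi_boundP; rewrite divr_ge0 // ltW // exprn_gt0.
  by rewrite /m -natr1; lra.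
pose K := (2 * #|{: {ffun W -> 'I_m}}|)%N.
have F0 : (0 < #|{: {ffun W -> 'I_m}}|)%N by apply/card_gt0P; exists [ffun => ord0].
have K0 : (0 < K)%N by rewrite muln_gt0.
have [n0 boxP] := box #|W| (enum 'I_m) K0.
exists n0 => V e or big0 dout din; have V0 : (0 < #|V|)%N by lia.
have irr v : e v v = false by apply/negP => evv; have := or _ _ evv; rewrite evv.
pose A (phi : {ffun W -> 'I_m}) := [set s : {ffun 'I_m -> V} |
   [forall x, forall y, a x y ==> e (s (phi x)) (s (phi y))]].
have AP (phi : {ffun W -> 'I_m}) (s : {ffun 'I_m -> V}) : reflect (forall x y, a x y -> e (s (phi x)) (s (phi y))) (s \in A phi).
  rewrite inE; apply: (iffP forallP) => [H x y axy|H x].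
    by have /forallP/(_ y)/implyP := H x; apply.
  by apply/forallP => y; apply/implyP; apply: H.
have h1 : h <= 1.
  have [v _] : exists v, v \in [set: V] by apply/card_gt0P; rewrite cardsT.
  have : (alpha + eps) * #|V|%:R <= 1 * #|V|%:R.
    by apply: le_trans (dout v) _; rewrite mul1r ler_nat max_card.
  rewrite ler_pM2r ?ltr0n // /h; lra.
have good (s : {ffun 'I_m -> V}) : #|bad_indices e b s|%:R < h * m%:R -> exists phi, s \in A phi.
  move=> few; pose H := {i | i \notin bad_indices e b s}.
  pose eH : rel H := fun i j => e (s (val i)) (s (val j)).
  have [||x|x|f fP] := hom H eH.
  - by move=> x y; apply: or.
  - rewrite card_sig (_ : #|_| = #|~: bad_indices e b s|); last by apply: eq_card => i; rewrite !inE.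
    have := cardsC (bad_indices e b s); rewrite card_ord => E.
    have : #|bad_indices e b s|%:R < m%:R :> R by apply: lt_le_trans few _; rewrite ler_piMl.
    by rewrite ltr_nat; move: E; clear; lia.
  - have := valP x; rewrite inE negb_or -!leNgt => /andP[le _].
    by have := good_deg bh few le; rewrite Eh.
  - have := valP x; rewrite inE negb_or -!leNgt => /andP[_ le].
    by have := good_deg bh few le; rewrite Eh.
  exists [ffun w => val (f w)]; apply/AP => x y axy; rewrite !ffunE; exact: fP axy.
have dout' v : (b + h) * #|V|%:R <= #|nbr e setT v|%:R by rewrite Eb.
have din' v : (b + h) * #|V|%:R <= #|nbr (converse e) setT v|%:R by rewrite Eb.
have mg := many_good V0 (ltn0Sn _ : (0 < m)%N) h0 dout' din' big.
have [phi Aphi] : exists phi, (#|{: {ffun 'I_m -> V}}| <= K * #|A phi|)%N.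
  case: (boolP [exists phi, (#|{: {ffun 'I_m -> V}}| <= K * #|A phi|)%N]).
    by case/existsP => phi ?; exists phi.
  rewrite negb_exists => /forallP no; exfalso.
  set G := [set s | _] in mg.
  have le : (#|G| <= \sum_phi #|A phi|)%N.
    apply: leq_trans (_ : \sum_(s in G) \sum_phi (s \in A phi) <= _)%N.
      rewrite -sum1_card; apply: leq_sum => s; rewrite inE => /good[phi sA].
      by rewrite (bigD1 phi) //= sA.
    rewrite exchange_big /=; apply: leq_sum => phi _.
    rewrite -sum1_card big_mkcond [X in (_ <= X)%N]big_mkcond /=.
    by apply: leq_sum => s _; case: (s \in G); case: (s \in A phi).
  have lt : (\sum_phi K * #|A phi| < #|{: {ffun W -> 'I_m}}| * #|{: {ffun 'I_m -> V}}|)%N.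
    have [p0 _] : exists p0, p0 \in {: {ffun W -> 'I_m}} by apply/card_gt0P.
    rewrite -sum_nat_const (bigD1 p0) //= [X in (_ < X)%N](bigD1 p0) //= -addSn leq_add //.
      by rewrite ltnNge.
    by apply: leq_sum => p _; apply: ltnW; rewrite ltnNge.
  move: lt; rewrite -big_distrr /= /K -mulnA mulnCA ltn_pmul2l // ltnNge => /negP; apply.
  by apply: leq_trans mg _; rewrite leq_mul2l.
have [X [Xi [s sX]]] := boxP V (A phi) big0 Aphi.
pose B w := [set X (phi w) i | i in 'I_#|W|].
have [w|f [fi fB]] := @distinct_choice W V B.
  by rewrite card_imset ?card_ord //; apply: Xi; rewrite mem_enum.
have pick w : exists i, f w = X (phi w) i by have /imsetP[i _ ->] := fB w; exists i.
exists f; split=> // x y axy; have [i Ei] := pick x; have [j Ej] := pick y.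
have val g : e (X (phi x) (g (phi x))) (X (phi y) (g (phi y))).
  by have /AP/(_ x y axy) := sX g; rewrite !ffunE !mem_enum.
(* a sample in A phi maps phi x and phi y to the ends of an arc *)
have ne : phi x != phi y.
  by apply/negP => /eqP E; have := val (fun=> i); rewrite E irr.
have := val (fun k => if k == phi x then i else j).
by rewrite eqxx eq_sym (negPf ne) Ei Ej.
Qed.

End Sampling.

(** * The threshold *)

Section Degrees.
Variable G : oriented_graph.

Lemma bigmin_leq (T : eqType) n (r : seq T) (F : T -> nat) x :
  x \in r -> (\big[minn/n]_(y <- r) F y <= F x)%N.
Proof.
elim: r => // y r IH; rewrite inE big_cons geq_min => /orP[/eqP->|/IH->].
  by rewrite leqnn.
by rewrite orbT.
Qed.

Lemma outdeg_nbr (x : G) : outdeg x = #|nbr (@Defs.arc G) setT x|.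
Proof. by apply: eq_card => y; rewrite !inE. Qed.

Lemma indeg_nbr (x : G) : indeg x = #|nbr (converse (@Defs.arc G)) setT x|.
Proof. by apply: eq_card => y; rewrite !inE. Qed.

Lemma min_semideg_out (x : G) : (min_semideg G <= #|nbr (@Defs.arc G) setT x|)%N.
Proof.
by rewrite -outdeg_nbr (leq_trans (geq_minl _ _)) // bigmin_leq // mem_index_enum.
Qed.

Lemma min_semideg_in (x : G) : (min_semideg G <= #|nbr (converse (@Defs.arc G)) setT x|)%N.
Proof.
by rewrite -indeg_nbr (leq_trans (geq_minr _ _)) // bigmin_leq // mem_index_enum.
Qed.

Lemma min_semideg_geq d : (d <= #|G|)%N -> (forall x : G, d <= outdeg x)%N ->
  (forall x : G, d <= indeg x)%N -> (d <= min_semideg G)%N.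
Proof.
move=> dG o i; rewrite leq_min; apply/andP.
by split; apply: (big_ind (fun a => d <= a)%N) => // a b da db; rewrite leq_min da.
Qed.

End Degrees.

Section Upper.
Variable C : oriented_cycle.

Lemma cycle_kP (t0 : (0 < cycle_type C)%N) : [/\ (2 < cycle_k t0)%N,
  ~~ (cycle_k t0 %| cycle_type C)%N &
  forall i, (2 < i)%N -> ~~ (i %| cycle_type C)%N -> (cycle_k t0 <= i)%N].
Proof.
rewrite /cycle_k; case: ex_minnP => k /andP[k2 nk] min; split=> // i i2 ni.
by apply: min; rewrite i2.
Qed.

(** If all edges of C point the same way, the type is the length, which is at
    least 3. *)
Lemma both_directions : ~ is_directed_triangle C -> (0 < cycle_type C <= 3)%N ->
  (exists i, @fwd C i) /\ (exists i, ~~ @fwd C i).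
Proof.
move=> ntri /andP[t0 t3]; have l3 := len_ge3 C.
have tot : (#|[set i | @fwd C i]| + #|[set i | ~~ @fwd C i]| = len C)%N.
  rewrite -[RHS]card_ord -(cardsC [set i | @fwd C i]); congr (_ + _)%N.
  by apply: eq_card => i; rewrite !inE.
have tri : (#|[set i | @fwd C i]| = 0 \/ #|[set i | ~~ @fwd C i]| = 0)%N -> len C = 3.
  move: t3 tot l3; rewrite /cycle_type; lia.
split; apply/existsP; apply: contraT; rewrite negb_exists => /forallP no; exfalso; apply: ntri.
  split; last by move=> i j; rewrite !(negPf (no _)).
  by apply: tri; left; apply/eqP; rewrite cards_eq0; apply/eqP/setP => i; rewrite !inE (negPf (no i)).
have al (i : 'I_(len C)) : fwd i by have := no i; rewrite negbK.
split; last by move=> i j; rewrite !al.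
by apply: tri; right; apply/eqP; rewrite cards_eq0; apply/eqP/setP => i; rewrite !inE al.
Qed.

(** The types 1 and 2 have k = 3, and the type 3 has k = 4. *)
Lemma hom_exists (t0 : (0 < cycle_type C)%N) (V : finType) (e : rel V) d (x : V) :
  ~ is_directed_triangle C -> dense_oriented (cycle_k t0) d e -> hom_cycle C e.
Proof.
move=> ntri; have [k2 nk mink] := cycle_kP t0; move: (cycle_k t0) k2 nk mink => k k2 nk mink de.
have out y : exists z, e y z by apply: dense_next de.
have inn y : exists z, e z y by apply: dense_next (dense_converse de).
have dv i : (2 < i < k)%N -> (i %| cycle_type C)%N.
  by case/andP => i2 ik; apply: contraT => /(mink i i2); rewrite leqNgt ik.
have [t3|t4] := leqP (cycle_type C) 3; last first.
  have [v wv] := closed_walk x de k2 dv nk t4.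
  exact: hom_closed_walk t0 wv.
have [ef eb] : (exists i, @fwd C i) /\ (exists i, ~~ @fwd C i).
  by apply: both_directions; rewrite // t0.
have [E|[E|E]] : (cycle_type C = 1 \/ cycle_type C = 2 \/ cycle_type C = 3)%N by lia.
- have Ek : k = 3 by apply/eqP; rewrite eqn_leq k2 andbT; apply: mink; rewrite ?E.
  rewrite Ek in de; have [u [v [euv w]]] := shortcut2 x de.
  by apply: (hom_shortcut out inn euv) => //; rewrite E.
- have Ek : k = 3 by apply/eqP; rewrite eqn_leq k2 andbT; apply: mink; rewrite ?E.
  rewrite Ek in de; have [u [v [euv w]]] := shortcut3 x de.
  by apply: (hom_shortcut out inn euv) => //; rewrite E.
have Ek : k = 4.
  apply/eqP; rewrite eqn_leq mink ?E //= ltn_neqAle k2 andbT.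
  by apply: contraNneq nk => <-; rewrite E.
rewrite Ek in de; case: (boolP [exists v, walk e 3 v v]) => [/existsP[v w]|].
  by apply: (@hom_closed_walk C V e v) => //; rewrite E.
rewrite negb_exists => /forallP cf.
have [u [v [euv w]]] := shortcut4 x de cf.
by apply: (hom_shortcut out inn euv) => //; rewrite E.
Qed.

Lemma contains_of (G : oriented_graph) (f : 'I_(len C) -> G) : injective f ->
  (forall x y, cycle_arc x y -> Defs.arc (f x) (f y)) -> contains G (cycle_graph C).
Proof. by move=> fi fa; exists f. Qed.

Lemma upper_bound (R : realType) (alpha eps : R) : 0 <= alpha -> 0 < eps ->
  (forall (V : finType) (e : rel V), (forall x y, e x y -> ~~ e y x) -> (0 < #|V|)%N ->
     (forall x, alpha * #|V|%:R < #|nbr e setT x|%:R) ->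
     (forall x, alpha * #|V|%:R < #|nbr (converse e) setT x|%:R) -> hom_cycle C e) ->
  exists n0 : nat, forall G : oriented_graph, (n0 <= #|G|)%N ->
    (alpha + eps) * #|G|%:R <= (min_semideg G)%:R -> contains G (cycle_graph C).
Proof.
move=> al0 eps0 hom; have [n0 H] := sampling al0 eps0 hom.
exists n0.+1 => G big deg.
have [||x|x|f [fi fa]] := H G (@Defs.arc G); rewrite ?big //.
- exact: arc_asym.
- by apply: le_trans deg _; rewrite ler_nat min_semideg_out.
- by apply: le_trans deg _; rewrite ler_nat min_semideg_in.
exact: contains_of fi fa.
Qed.

End Upper.

Section Lower.

Section BlowUp.
Variables (k q : nat) (k3 : (2 < k)%N).
Definition blowup_arc : rel ('I_k * 'I_q) := fun p p' => p'.1 == ordS p.1.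

Lemma blowup_irrefl p : ~~ blowup_arc p p.
Proof. exact: (@ordS_neq (@OrientedCycle k k3 predT)). Qed.

Lemma blowup_asym p p' : blowup_arc p p' -> ~~ blowup_arc p' p.
Proof. by move/eqP=> E; rewrite /blowup_arc E; apply: (@ordSS_neq (@OrientedCycle k k3 predT)). Qed.

Definition blowup := OrientedGraph blowup_irrefl blowup_asym.

Lemma blowup_card : #|blowup| = (k * q)%N.
Proof. by rewrite /= card_prod !card_ord. Qed.

Lemma blowup_semideg : (q <= min_semideg blowup)%N.
Proof.
apply: min_semideg_geq.
- by rewrite blowup_card leq_pmull //; lia.
- move=> p; rewrite /outdeg.
  apply: leq_trans (_ : #|[set (ordS p.1, a) | a in 'I_q]| <= _)%N.
    by rewrite card_imset ?card_ord // => a b [].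
  by apply: subset_leq_card; apply/subsetP => z /imsetP[a _ ->]; rewrite inE /= /blowup_arc.
move=> p; rewrite /indeg.
apply: leq_trans (_ : #|[set (ord_pred p.1, a) | a in 'I_q]| <= _)%N.
  by rewrite card_imset ?card_ord // => a b [].
apply: subset_leq_card; apply/subsetP => z /imsetP[a _ ->].
by rewrite inE /= /blowup_arc /= ord_predK.
Qed.

(** Following C, the class in the k-cycle changes by the height modulo k, and
    it returns after one turn. *)
Lemma blowup_free C : ~~ (k %| cycle_type C)%N -> ~ contains blowup (cycle_graph C).
Proof.
move=> nk [f [_ fa]]; case/negP: nk.
pose g (j : nat) : nat := (f (Ordinal (ltn_pmod j (len_gt0 C)))).1.
have next (x : 'I_k) : exists z : int, Posz (ordS x) = Posz x + 1 - z * Posz k.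
  exists (Posz (x.+1 %/ k)); have := divn_eq x.+1 k.
  change (nat_of_ord (ordS x)) with (x.+1 %% k)%N.
  by move: (x.+1 %/ k)%N (x.+1 %% k)%N => a b; clear; lia.
(* class of the j-th vertex = class of the first + height, modulo k *)
have pot j : exists z : int, Posz (g j) = Posz (g 0) + height C 0 j + z * Posz k.
  elim: j => [|j [z Ez]]; first by exists 0; rewrite height0 mul0r !addr0.
  set i := Ordinal (ltn_pmod j (len_gt0 C)).
  have Ei : Ordinal (ltn_pmod j.+1 (len_gt0 C)) = ordS i.
    by apply: val_inj; rewrite /= -addn1 -[in RHS]addn1 modnDml.
  rewrite heightS add0n /g Ei /arrow -/i; rewrite /g -/i in Ez.
  case fi : (fwd i).
    have /eqP E : blowup_arc (f i) (f (ordS i)) by apply: fa; rewrite /= /cycle_arc eqxx fi.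
    have [z' Ez'] := next (f i).1; exists (z - z'); rewrite E /arrow_sign Ez' Ez; ring.
  have /eqP E : blowup_arc (f (ordS i)) (f i) by apply: fa; rewrite /= /cycle_arc eqxx fi orbT.
  have [z' Ez'] := next (f (ordS i)).1; exists (z + z'); rewrite E Ez' in Ez.
  rewrite /arrow_sign; set u := nat_of_ord (f (ordS i)).1 in Ez *.
  by have -> : Posz u = (Posz u + 1 - z' * Posz k) - 1 + z' * Posz k by [ring]; rewrite Ez; ring.
have [z Ez] := pot (len C).
have Eg : g (len C) = g 0.
  by rewrite /g; congr (val (f _).1); apply: val_inj => /=; rewrite modnn mod0n.
rewrite -(height_type C) (_ : height C 0 (len C) = - z * Posz k); last by lia.
by rewrite abszM dvdn_mull.
Qed.

End BlowUp.

Definition empty_arc n : rel 'I_n := fun _ _ => false.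
Definition edgeless n := @OrientedGraph 'I_n (@empty_arc n) (fun _ => isT)
  (fun _ _ (h : false) => False_ind _ (Bool.diff_false_true h)).

Lemma edgeless_free n C : ~ contains (edgeless n) (cycle_graph C).
Proof.
move=> [f [_ fa]]; pose i := Ordinal (len_gt0 C).
case fi : (fwd i).
  by have /= := fa i (ordS i); rewrite /cycle_arc eqxx fi /empty_arc => /(_ isT).
by have /= := fa (ordS i) i; rewrite /cycle_arc eqxx fi orbT /empty_arc => /(_ isT).
Qed.

End Lower.

Theorem theorem7p1 (R : realType) (C : oriented_cycle) :
  ~ is_directed_triangle C ->
  (forall eps : R, 0 < eps ->
     exists n0 : nat, forall G : oriented_graph, (n0 <= #|G|)%N ->
       (forall t_gt0 : (0 < cycle_type C)%N,
          (min_semideg G)%:R >=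
            #|G|%:R / (cycle_k t_gt0)%:R + eps * #|G|%:R ->
          contains G (cycle_graph C)) /\
       (cycle_type C = 0%N ->
          (min_semideg G)%:R >= eps * #|G|%:R ->
          contains G (cycle_graph C))) /\
  (forall (t_gt0 : (0 < cycle_type C)%N) (c : R), c < 1 / (cycle_k t_gt0)%:R ->
     forall N : nat, exists n : nat, (N <= n)%N /\
       exists G : oriented_graph,
         #|G| = n /\
         (min_semideg G)%:R >= c * n%:R /\
         ~ contains G (cycle_graph C)) /\
  (cycle_type C = 0%N -> forall c : R, c < 0 ->
     forall N : nat, exists n : nat, (N <= n)%N /\
       exists G : oriented_graph,
         #|G| = n /\
         (min_semideg G)%:R >= c * n%:R /\
         ~ contains G (cycle_graph C)).
Proof.
move=> ntri; split; [|split].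
- move=> eps eps0; have [t0|t0] : (cycle_type C = 0 \/ 0 < cycle_type C)%N by lia.
    have [|n0 H] := @upper_bound C R 0 eps (lexx 0) eps0.
      move=> V e _ /card_gt0P[x _] out inn.
      apply: (hom_balanced _ _ x t0) => y; [have := out y|have := inn y];
        by rewrite mul0r ltr0n => /card_gt0P[z]; rewrite in_out; exists z.
    exists n0 => G big; split=> [t1|_ deg]; first by exfalso; move: t1; rewrite t0.
    by apply: H => //; rewrite add0r.
  (* semidegree above |V|/k is turned into d = floor(|V|/k) + 1 *)
  have [k2 _ _] := cycle_kP t0; set k := cycle_k t0 in k2.
  have k0 : 0 < k%:R :> R by rewrite ltr0n; lia.
  have [||n0 H] := @upper_bound C R k%:R^-1 eps _ eps0.
  + by rewrite invr_ge0 ltW.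
  + move=> V e or /card_gt0P[x _] out inn.
    apply: (hom_exists (t0 := t0) (d := (#|V| %/ k).+1) x) => //.
    have deg (m : nat) : k%:R^-1 * #|V|%:R < m%:R :> R -> (#|V| %/ k < m)%N.
      rewrite mulrC ltr_pdivrMr // -natrM ltr_nat => lt.
      by rewrite ltn_divLR //; lia.
    split=> // [y|y|]; [exact: deg|exact: deg|].
    by rewrite mulnC ltn_ceil //; lia.
  exists n0 => G big; split=> [t1 deg|E]; last by exfalso; have := t0; rewrite E.
  move: deg; rewrite (_ : cycle_k t1 = k); last by rewrite (bool_irrelevance t1 t0).
  by move=> deg; apply: H => //; rewrite mulrDl (mulrC k%:R^-1).
- move=> t0 c ck N; have [k2 nk _] := cycle_kP t0; move: (cycle_k t0) ck k2 nk => k ck k2 nk.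
  exists (k * N)%N; split; first by rewrite leq_pmull //; lia.
  exists (blowup N k2); split; [exact: blowup_card|split; last exact: blowup_free].
  apply: le_trans (_ : N%:R <= _); last by rewrite ler_nat blowup_semideg.
  rewrite natrM mulrA; apply: ler_piMl => //.
  by rewrite -ler_pdivlMr ?ltr0n; [apply: ltW|lia].
move=> t0 c c0 N; exists N; split=> //; exists (edgeless N); split; first exact: card_ord.
split; last exact: edgeless_free.
by apply: le_trans (_ : 0 <= _); rewrite ?ler0n // mulr_le0_ge0 ?ler0n // ltW.
Qed.
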